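(* For $n,m\in\mathbb{N}$ let $h(n,m)$ denote the number of partitions of $n$ into $m$ parts such that each part appears at most twice, and let $H(t;q)=\prod_{n=1}^{\infty}(1+tq^n+t^2q^{2n})$. Then $$H(t;q)=\sum_{m,n\ge0}h(n,m)q^nt^m=\sum_{\substack{m_1,m_2,m_3,\\ m,n_{12}\ge0}}\frac{P(m_1,m_2,m_3,m+1;q)\,q^{mn_{12}+n_{12}^2}\,t^{2m_1+2m_2+5m_3+n_{12}}}{(q;q)_{n_{12}}(q^3;q^3)_{m_1+m_2+2m_3}},$$ where the $P(m_1,m_2,m_3,m+1;q)$ are the polynomials in $q$ with (evidently) nonnegative coefficients defined in the context.
   Context: A partition is a finite nondecreasing sequence of positive integers (possibly empty); its weight is the sum of its parts. $|q|<1$ (or: identities of formal power series). $(a;q)_0=1$, $(a;q)_n=(1-a)(1-aq)\cdots(1-aq^{n-1})$. The polynomials $P$. The following notions concern partitions in which each part appears at most twice. Pairs and singletons. Read the parts $\lambda_1\le\lambda_2\le\cdots$ from left to right: at the current part $\lambda_i$, if $\lambda_{i+1}$ exists and $\lambda_{i+1}-\lambda_i\in\{0,1\}$, then $[\lambda_i,\lambda_{i+1}]$ is declared a pair and one continues with $\lambda_{i+2}$; otherwise $\lambda_i$ is declared a singleton and one continues with $\lambda_{i+1}$. So each pair is a pair of repeating parts $[k,k]$ or a pair of consecutive parts $[k,k+1]$. Backward moves on pairs. A backward move on a pair replaces $[k,k+1]$ by $[k-1,k-1]$, or $[k,k]$ by $[k-2,k-1]$ (after which the parts are re-sorted and pairs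 are determined anew). It is possible only if all parts of the result are positive, each part of the result appears at most twice, and the pair is not moved through another pair, i.e. the smaller part of the moved pair is at least the larger part of the immediately preceding pair (if there is one). Base partitions. A base partition is a partition $\beta$ with each part appearing at most twice such that (i) no backward move is possible on any pair of $\beta$; (ii) the singletons located after the last (largest) pair (all singletons, if there are no pairs) are exactly $k+1,k+3,\dots,k+2n_{12}-1$ for some $n_{12}\ge0$, where the largest pair is $[k,k]$ or $[k,k+1]$, and $k=0$ if there are no pairs. The singletons in (ii) are called moveable; the other singletons, lying between pairs, are called immobile. Blocks. A block of a base partition is a group of five parts of the form $[k-1,k],k,[k+2,k+2]$ (two successive pairs with an immobile singleton $k$ between them). Definition of $P$. For $m_1,m_2,m_3\in\mathbb{N}$ not all zero and $m\in\mathbb{Z}$, $P(m_1,m_2,m_3,m+1;q)=\sum_\beta q^{w(\beta)}$, the sum over base partitions $\beta$ without moveable singletons having exactly $m_3$ blocks, $m_1$ pairs of repeating parts not contained in blocks, and $m_2$ pairs of consecutive parts not contained in blocks, and whose largest pair is $[m,m]$ or $[m,m+1]$; $w(\beta)$ is the weight. Also $P(0,0,0,1;q)=1$ and $P(0,0,0,m+1;q)=0$ for $m\ne0$. *)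

(* Defs.v *)
From HB Require Import structures.
From mathcomp Require Import all_boot all_order all_algebra.
From mathcomp Require Import boolp.

Set Implicit Arguments.
Unset Strict Implicit.
Unset Printing Implicit Defensive.

Import GRing.Theory.
Local Open Scope ring_scope.

Record fps (R : Type) := Fps { fps_coef : nat -> R }.

Lemma fpsP (R : Type) (f g : fps R) :
  (forall n, fps_coef f n = fps_coef g n) -> f = g.
Proof. by case: f g => [f] [g] /= fg; congr Fps; apply/funext. Qed.

HB.instance Definition _ (R : Type) := gen_eqMixin (fps R).
HB.instance Definition _ (R : Type) := gen_choiceMixin (fps R).

Section FpsZmodule.
Variable R : zmodType.
Implicit Types f g : fps R.

Definition fps_zero : fps R := Fps (fun=> 0).
Definition fps_opp f : fps R := Fps (fun n => - fps_coef f n).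
Definition fps_add f g : fps R := Fps (fun n => fps_coef f n + fps_coef g n).

Fact fps_addA : associative fps_add.
Proof. by move=> f g h; apply: fpsP => n /=; rewrite addrA. Qed.
Fact fps_addC : commutative fps_add.
Proof. by move=> f g; apply: fpsP => n /=; rewrite addrC. Qed.
Fact fps_add0 : left_id fps_zero fps_add.
Proof. by move=> f; apply: fpsP => n /=; rewrite add0r. Qed.
Fact fps_addN : left_inverse fps_zero fps_opp fps_add.
Proof. by move=> f; apply: fpsP => n /=; rewrite addNr. Qed.

HB.instance Definition _ :=
  GRing.isZmodule.Build (fps R) fps_addA fps_addC fps_add0 fps_addN.

End FpsZmodule.

Section FpsRing.
Variable R : comNzRingType.
Implicit Types f g : fps R.

Definition fpsC (c : R) : fps R := Fps (fun n => if n == 0%N then c else 0).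
Definition fpsX : fps R := Fps (fun n => (n == 1%N)%:R).
Definition fps_of_poly (p : {poly R}) : fps R := Fps (fun n => p`_n).

Definition fps_mul f g : fps R :=
  Fps (fun n => \sum_(i < n.+1) fps_coef f i * fps_coef g (n - i)).

Definition fps_trunc (N : nat) f : {poly R} := \poly_(i < N) fps_coef f i.

Lemma fps_mul_trunc (N n : nat) f g : (n < N)%N ->
  fps_coef (fps_mul f g) n = (fps_trunc N f * fps_trunc N g)`_n.
Proof.
move=> nN; rewrite coefM /=; apply: eq_bigr => i _.
rewrite !coef_poly (leq_ltn_trans (leq_subr _ _) nN).
by rewrite (leq_trans (ltn_ord i) nN).
Qed.

Fact fps_mulC : commutative fps_mul.
Proof.
by move=> f g; apply: fpsP => n; rewrite !(@fps_mul_trunc n.+1) // mulrC.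
Qed.

Fact fps_mulA : associative fps_mul.
Proof.
move=> f g h; apply: fpsP => n.
transitivity ((fps_trunc n.+1 f * (fps_trunc n.+1 g * fps_trunc n.+1 h))`_n).
  rewrite coefM /=; apply: eq_bigr => i _; rewrite coef_poly ltn_ord; congr (_ * _).
  by rewrite -fps_mul_trunc // ltnS leq_subr.
rewrite mulrA coefM /=; apply: eq_bigr => i _; congr (_ * _).
  by rewrite -fps_mul_trunc // ltn_ord.
by rewrite coef_poly ltnS leq_subr.
Qed.

Fact fps_mul1 : left_id (fpsC 1) fps_mul.
Proof.
move=> f; apply: fpsP => n /=.
by rewrite big_ord_recl /= subn0 mul1r big1 ?addr0 // => i _; rewrite mul0r.
Qed.

Fact fps_mulDl : left_distributive fps_mul +%R.
Proof.
move=> f g h; apply: fpsP => n /=.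
by rewrite -big_split; apply: eq_bigr => i _ /=; rewrite mulrDl.
Qed.

Fact fps_one_neq0 : fpsC 1 != 0.
Proof.
apply/eqP => /(congr1 (fun f => fps_coef f 0)) /= /eqP.
by rewrite oner_eq0.
Qed.

HB.instance Definition _ := GRing.Zmodule_isComNzRing.Build (fps R)
  fps_mulA fps_mulC fps_mul1 fps_mulDl fps_one_neq0.

End FpsRing.

Arguments fpsX {R}.

Section FpsUnitRing.
Variable R : comUnitRingType.
Implicit Types f g : fps R.

(* The coefficients of order n, n - 1, ..., 0 of the inverse of f. *)
Fixpoint fps_inv_seq f (n : nat) : seq R :=
  if n is n'.+1 then
    let s := fps_inv_seq f n' in
    (- (fps_coef f 0)^-1 * \sum_(i < n) fps_coef f i.+1 * s`_i) :: s
  else [:: (fps_coef f 0)^-1].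

Definition fps_unit : pred (fps R) := fun f => fps_coef f 0 \is a GRing.unit.

Definition fps_inv f : fps R :=
  if fps_unit f then Fps (fun n => (fps_inv_seq f n)`_0) else f.

Lemma nth_fps_inv_seq f (n i : nat) : (i <= n)%N ->
  (fps_inv_seq f n)`_i = (fps_inv_seq f (n - i))`_0.
Proof.
elim: n i => [|n IHn] [|i] //= lein.
by rewrite IHn // subSS.
Qed.

Fact fps_mulVx : {in fps_unit, left_inverse 1 fps_inv *%R}.
Proof.
move=> f Uf; rewrite mulrC /fps_inv ifT //; move: Uf; rewrite unfold_in => Uf.
apply: fpsP => -[|n] /=; first by rewrite big_ord1 divrr.
rewrite big_ord_recl /= mulrA mulrN divrr // mulN1r.
apply/eqP; rewrite addrC subr_eq0; apply/eqP; apply: eq_bigr => i _.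
by rewrite [RHS]/= [in RHS]nth_fps_inv_seq -1?ltnS // /bump add1n subSS.
Qed.

Fact fps_unitPl f g : g * f = 1 -> fps_unit f.
Proof.
move=> /(congr1 (fun h => fps_coef h 0)) /=; rewrite big_ord1 => gf1.
by apply/unitrPr; exists (fps_coef g 0); rewrite mulrC.
Qed.

Fact fps_inv_out : {in [predC fps_unit], fps_inv =1 id}.
Proof. by move=> f Uf; rewrite /fps_inv ifN. Qed.

HB.instance Definition _ := GRing.ComNzRing_hasMulInverse.Build (fps R)
  fps_mulVx fps_unitPl fps_inv_out.

End FpsUnitRing.

(* Z[[q, t]] is represented as Z[[q]][[t]]. *)

Notation Zqt := (fps (fps int)).

Definition qvar : Zqt := fpsC fpsX.
Definition tvar : Zqt := fpsX.

(* The coefficient of q^n t^m. *)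
Definition coef_qt (F : Zqt) (n m : nat) : int := fps_coef (fps_coef F m) n.

(* The family F is summable (locally finite), with sum S. *)
Definition sums_to (I : eqType) (F : I -> Zqt) (S : Zqt) : Prop :=
  forall n m : nat, exists s : seq I,
    [/\ uniq s,
        (forall i, i \notin s -> coef_qt (F i) n m = 0)
      & coef_qt S n m = \sum_(i <- s) coef_qt (F i) n m].

(* The infinite product of the F i, i >= 1, converges to H: each coefficient
   of the partial products is eventually equal to that of H. *)
Definition prod_converges_to (F : nat -> Zqt) (H : Zqt) : Prop :=
  forall n m : nat, exists N0 : nat, forall N : nat, (N0 <= N)%N ->
    coef_qt (\prod_(1 <= i < N.+1) F i) n m = coef_qt H n m.

Definition qpoch (R : comUnitRingType) (a q : R) (n : nat) : R :=
  \prod_(i < n) (1 - a * q ^+ i).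

Definition is_partition (s : seq nat) : bool :=
  sorted leq s && all (leq 1) s.

Definition at_most_twice (s : seq nat) : bool :=
  all (fun x => count_mem x s <= 2)%N s.

(* The number of partitions of n satisfying A. A partition of n has at most n
   parts, and its parts are at most n, whence the finite type (see
   [partition_bseq]). *)
Definition num_partitions (A : pred (seq nat)) (n : nat) : nat :=
  #|[set b : n.-bseq 'I_n.+1 | let s := [seq val i | i <- b] in
      [&& is_partition s, sumn s == n & A s]]|.

Lemma partition_bseq (n : nat) (s : seq nat) :
  is_partition s -> sumn s = n ->
  exists b : n.-bseq 'I_n.+1, [seq val i | i <- b] = s.
Proof.
move=> /andP[_ s_gt0] sn.
have size_s : (size s <= n)%N.
  rewrite -sn; elim: s s_gt0 {sn} => //= x s IHs /andP[x_gt0 /IHs].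
  exact: (@leq_add 1).
have s_le : all (fun x => x < n.+1)%N s.
  apply/allP => x xs; rewrite ltnS -sn.
  elim: s xs {sn s_gt0 size_s} => //= y s IHs; rewrite inE.
  by case/orP => [/eqP->|/IHs]; [exact: leq_addr|move/leq_trans; apply; exact: leq_addl].
have bn : (size [seq (inord x : 'I_n.+1) | x <- s] <= n)%N by rewrite size_map.
exists (Bseq bn) => /=; rewrite -map_comp -[RHS]map_id.
by apply/eq_in_map => x /(allP s_le) xn /=; rewrite inordK.
Qed.

(* The sum of q^|s| over the partitions s satisfying A. *)
Definition genfun (A : pred (seq nat)) : fps int :=
  Fps (fun n => (num_partitions A n)%:Z).

Definition h (n m : nat) : nat :=
  num_partitions (fun s => at_most_twice s && (size s == m)) n.

(* A partition is read as a sequence of items: [inl k] is the singleton k and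
   [inr (a, b)] is the pair a, b. *)

Notation item := (nat + nat * nat)%type.

Fixpoint items (s : seq nat) : seq item :=
  if s is a :: s1 then
    if s1 is b :: s2 then
      if (b == a) || (b == a.+1) then inr (a, b) :: items s2
      else inl a :: items s1
    else [:: inl a]
  else [::].

Definition parts_of (its : seq item) : seq nat :=
  flatten [seq match x with inl k => [:: k] | inr (a, b) => [:: a; b] end
          | x <- its].

Definition get_pair (x : item) : option (nat * nat) :=
  if x is inr p then Some p else None.
Definition get_singleton (x : item) : option nat :=
  if x is inl k then Some k else None.

(* Without pairs this is (0, 0): k = 0 in [base_partition], and no constraint
   from a preceding pair in [can_move_back]. *)
Definition last_pair (its : seq item) : nat * nat :=
  last (0, 0)%N (pmap get_pair its).

(* Truncated subtraction is harmless here: whenever it truncates, the moved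
   pair has a part equal to 0, and the move is rejected by [can_move_back]. *)
Definition move_back (p : nat * nat) : nat * nat :=
  if p.2 == p.1 then (p.1 - 2, p.1 - 1)%N else (p.1 - 1, p.1 - 1)%N.

Definition can_move_back (its : seq item) (i : nat) : bool :=
  if nth (inl 0%N) its i is inr p then
    let before := take i its in
    let after := drop i.+1 its in
    let p' := move_back p in
    let result := sort leq (parts_of (before ++ inr p' :: after)) in
    [&& all (leq 1) result, at_most_twice result
      & ((last_pair before).2 <= p'.1)%N]
  else false.

(* The [find] computes the number of items located after the last pair. *)
Definition moveable (its : seq item) : seq nat :=
  pmap get_singleton
    (drop (size its - find (fun x => get_pair x : bool) (rev its)) its).

Definition base_partition (s : seq nat) : bool :=
  let its := items s in
  let k := (last_pair its).1 in
  [&& is_partition s, at_most_twice s,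
      all (fun i => ~~ can_move_back its i) (iota 0 (size its))
    & moveable its == mkseq (fun i => k + i.*2.+1)%N (size (moveable its))].

Definition block_at (its : seq item) (j : nat) : bool :=
  if drop j its is inr (a, b) :: inl k :: inr (c, d) :: _ then
    [&& a.+1 == k, b == k, c == k.+2 & d == k.+2]
  else false.

Definition in_block (its : seq item) (i : nat) : bool :=
  has (fun j => block_at its j && (j <= i <= j.+2)%N) (iota 0 (size its)).

Definition num_blocks (its : seq item) : nat :=
  count (block_at its) (iota 0 (size its)).

Definition num_free_pairs (A : pred (nat * nat)) (its : seq item) : nat :=
  count (fun i => ~~ in_block its i &&
           (if nth (inl 0%N) its i is inr p then A p else false))
        (iota 0 (size its)).

(* The last argument M stands for m + 1, where the largest pair is m, m or
   m, m + 1. If m1, m2, m3 are not all zero, there is a pair, so that the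
   default value of [last_pair] is not used. *)
Definition P (m1 m2 m3 : nat) (M : int) : fps int :=
  if [&& m1 == 0%N, m2 == 0%N & m3 == 0%N] then
    if M == 1 then 1 else 0
  else genfun (fun s => let its := items s in
    [&& base_partition s, moveable its == [::],
        num_blocks its == m3,
        num_free_pairs (fun p => p.2 == p.1) its == m1,
        num_free_pairs (fun p => p.2 == p.1.+1) its == m2
      & (last_pair its).1%:Z + 1 == M]).

(* Main.v *)
From HB Require Import structures.
Require Import Defs.
From mathcomp Require Import all_boot all_order all_algebra.
From mathcomp Require Import zify ring.

Set Implicit Arguments.
Unset Strict Implicit.
Unset Printing Implicit Defensive.

Import GRing.Theory Num.Theory.
Local Open Scope ring_scope.

(** Why the identity holds.

    A partition in which each part occurs at most twice is the same thing as
    the word of its pairs and singletons.  A pair is determined by its weight w: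
    it consists of w/2 rounded down and w/2 rounded up.  The words that occur
    are those accepted by an automaton whose states are natural numbers: the
    initial state is 0; from the state u one may read a pair of weight w >= u+2,
    which leads to the state w, or a singleton s with 2s > u, which leads to the
    state 2s+2 ([chain_items], [chain_parts_of]).  Thus a singleton s acts on
    what follows it like a pair of weight 2s+2.

    Let g u r n be the generating function of the words with r pairs and n
    singletons that are accepted from the state u.  Replacing u by u+1 loses
    only the words that begin with a pair of weight u+2, or with the singleton
    (u+1)/2 if u is odd; this gives a recurrence ([chain_gf_step]) on which
    everything else rests.

    A backward move lowers the weight of a pair by 3.  Moving every pair back
    once, from the smallest to the largest, should therefore show that
    q^(3r) g u r n enumerates the words whose first pair can be moved back.
    Rather than by a bijection this is proved from the recurrence: by
    induction on r and n the difference of the two sides does not depend on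
    u, and it tends to 0 in the q-adic topology as u grows
    ([chain_gf_shift_pairs]). Here the state u is regarded as a preceding
    pair of weight u. Subtracting, (1 - q^(3r)) g u r n enumerates the words
    whose first pair is frozen: it is of weight u+2, u+3 or u+4, or the last
    pair of a block that begins with the pair of weight u
    ([chain_gf_frozen_pair]). Iterating, (q^3;q^3)_r g 0 r n becomes a
    finite sum over the words in which every pair is frozen, each followed
    by freely placed singletons ([packed_sum]). The latter contribute
    q^(mn+n^2) / (q;q)_n, again by the recurrence ([chain_gf_singletons]).

    The words in which every pair is frozen, with no singleton after the last
    pair, are the base partitions without moveable singletons
    ([base_partition_packed]), and their immobile singletons are exactly those
    of the blocks ([packed_typeE]).  Hence P m1 m2 m3 (m+1) is a finite sum of
    powers of q ([P_packed]), and sorting the words by m1, m2, m3, m and n12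
    gives the identity ([Hseries_sum_P]). *)

(** * Coefficients of formal power series *)

Section FpsCoef.
Variable R : comNzRingType.
Implicit Types f g : fps R.

Lemma fps_coefD f g n : fps_coef (f + g) n = fps_coef f n + fps_coef g n.
Proof. by []. Qed.

Lemma fps_coefB f g n : fps_coef (f - g) n = fps_coef f n - fps_coef g n.
Proof. by []. Qed.

Lemma fps_coef_sum (I : Type) (r : seq I) (p : pred I) (F : I -> fps R) n :
  fps_coef (\sum_(i <- r | p i) F i) n = \sum_(i <- r | p i) fps_coef (F i) n.
Proof.
by apply: (big_morph (fun f => fps_coef f n)) => // f g; rewrite fps_coefD.
Qed.

Lemma fps_coefXM f n :
  fps_coef (fpsX * f) n = if n is n'.+1 then fps_coef f n' else 0.
Proof.
case: n => [|n]; first by rewrite /= big_ord1 mul0r.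
rewrite /= 2!big_ord_recl /= mul0r add0r mul1r big1 => [|i _]; last exact: mul0r.
by rewrite addr0 subSS subn0.
Qed.

Lemma fps_coefXnM k f n :
  fps_coef (fpsX ^+ k * f) n = if (k <= n)%N then fps_coef f (n - k) else 0.
Proof.
elim: k n => [|k IHk] n; first by rewrite expr0 mul1r subn0.
by rewrite exprS -mulrA fps_coefXM; case: n => [|n] //; rewrite IHk subSS.
Qed.

Lemma fps_coefXn k n : fps_coef (fpsX ^+ k : fps R) n = (n == k)%:R.
Proof.
rewrite -[_ ^+ _]mulr1 fps_coefXnM /=; case: leqP => kn; last by rewrite (ltn_eqF kn).
by rewrite subn_eq0 eqn_leq kn andbT; case: leqP.
Qed.

Lemma fps_coefCM c f n : fps_coef (fpsC c * f) n = c * fps_coef f n.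
Proof.
rewrite /= big_ord_recl /= subn0 big1 ?addr0 // => i _.
by rewrite mul0r.
Qed.

Fact fpsC_is_zmod_morphism : zmod_morphism (@fpsC R).
Proof. by move=> a b; apply: fpsP => -[|n] /=; rewrite ?subr0. Qed.

Fact fpsC_is_monoid_morphism : monoid_morphism (@fpsC R).
Proof.
split=> // a b; apply: fpsP => -[|n]; rewrite fps_coefCM //=.
by rewrite mulr0.
Qed.

HB.instance Definition _ :=
  GRing.isZmodMorphism.Build R (fps R) (@fpsC R) fpsC_is_zmod_morphism.
HB.instance Definition _ :=
  GRing.isMonoidMorphism.Build R (fps R) (@fpsC R) fpsC_is_monoid_morphism.

End FpsCoef.

Lemma fps_coefCXn (R : comNzRingType) (a : R) k n :
  fps_coef (fpsC a * fpsX ^+ k) n = if n == k then a else 0.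
Proof. by rewrite fps_coefCM fps_coefXn mulrb; case: eqP; rewrite ?mulr1 ?mulr0. Qed.

Lemma fpsCXn (R : comNzRingType) (a : R) n : fpsC (a ^+ n) = fpsC a ^+ n.
Proof. exact: rmorphXn. Qed.

Lemma fpsCM (R : comNzRingType) (a b : R) : fpsC (a * b) = fpsC a * fpsC b.
Proof. exact: rmorphM. Qed.

Lemma fpsC_nat (R : comNzRingType) n : fpsC (n%:R : R) = n%:R.
Proof. exact: rmorph_nat. Qed.

Lemma fpsCV (R : comUnitRingType) (a : R) :
  a \is a GRing.unit -> fpsC a^-1 = (fpsC a)^-1.
Proof. exact: rmorphV. Qed.

Lemma fps_unitE (R : comUnitRingType) (f : fps R) :
  (f \is a GRing.unit) = (fps_coef f 0 \is a GRing.unit).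
Proof. by []. Qed.

Lemma unit_qpoch (R : comUnitRingType) k n :
  qpoch (fpsX ^+ k.+1) (fpsX ^+ k.+1) n \is a @GRing.unit (fps R).
Proof.
apply: (big_ind (fun f : fps R => f \is a GRing.unit)) => [|f g uf ug|i _].
- exact: unitr1.
- by rewrite unitrM uf ug.
by rewrite fps_unitE fps_coefB exprS -mulrA fps_coefXM subr0 unitr1.
Qed.

Lemma fpsC_qpoch (R : comUnitRingType) (a q : R) n :
  fpsC (qpoch a q n) = qpoch (fpsC a) (fpsC q) n.
Proof.
rewrite /qpoch rmorph_prod; apply: eq_bigr => i _.
by rewrite rmorphB rmorph1 rmorphM rmorphXn.
Qed.

(** * Generating functions of classes of objects *)

Section Gf.
Variables (T : eqType) (w : T -> nat).
Implicit Types (A B : pred T) (F G : fps int).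

(** A relation between a class and a series: any duplicate-free list of the
    objects of a given weight may serve to compute a coefficient, so that
    bijections and partitions of classes transfer without choosing canonical
    enumerations. *)
Definition is_genfun (A : pred T) (F : fps int) : Prop :=
  forall n, exists l : seq T,
    [/\ uniq l, forall x, (x \in l) = A x && (w x == n)
      & fps_coef F n = (size l)%:Z].

Lemma is_genfun_inj A F G : is_genfun A F -> is_genfun A G -> F = G.
Proof.
move=> AF AG; apply: fpsP => n.
have [l [Ul lA ->]] := AF n; have [l' [Ul' l'A ->]] := AG n.
by congr Posz; apply/perm_size/uniq_perm => // x; rewrite lA l'A.
Qed.

Lemma eq_is_genfun A B F : A =1 B -> is_genfun A F -> is_genfun B F.
Proof.
by move=> AB AF n; have [l [Ul lA nl]] := AF n; exists l; split=> // x; rewrite -AB.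
Qed.

Lemma is_genfun0 A : (forall x, ~~ A x) -> is_genfun A 0.
Proof. by move=> A0 n; exists [::]; split=> // x; rewrite (negPf (A0 x)). Qed.

Lemma is_genfunU A B F G :
  (forall x, A x -> ~~ B x) -> is_genfun A F -> is_genfun B G ->
  is_genfun (fun x => A x || B x) (F + G).
Proof.
move=> AB AF BG n; have [l [Ul lA nl]] := AF n; have [m [Um mB nm]] := BG n.
exists (l ++ m); split; last by rewrite fps_coefD nl nm size_cat PoszD.
  rewrite cat_uniq Ul Um andbT /=; apply/hasPn => x; rewrite mB lA.
  by case/andP => Bx _; apply/negP => /andP[/AB]; rewrite Bx.
by move=> x; rewrite mem_cat lA mB andb_orl.
Qed.

Lemma is_genfun_sum (I : eqType) (r : seq I) (key : T -> I) A (F : I -> fps int) :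
  uniq r -> (forall x, A x -> key x \in r) ->
  (forall i, i \in r -> is_genfun (fun x => A x && (key x == i)) (F i)) ->
  is_genfun A (\sum_(i <- r) F i).
Proof.
move=> Ur Ar; elim: r A Ur Ar => [|i r IHr] A /= => [_ A0 _|/andP[ir Ur] Ar AF].
  by rewrite big_nil; apply: is_genfun0 => x; apply/negP => /A0.
rewrite big_cons.
have AB x : A x && (key x == i) || (A x && (key x != i)) = A x.
  by case: (A x); case: (key x == i).
apply: (eq_is_genfun AB); apply: is_genfunU; first by move=> x /andP[_ ->]; rewrite andbF.
  by apply: AF; rewrite mem_head.
apply: IHr => // [x /andP[/Ar]|j jr]; first by rewrite inE => /orP[->|].
apply: eq_is_genfun (AF j _); last by rewrite inE jr orbT.
move=> x /=; case: eqP => [->|]; rewrite ?andbF ?andbT //.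
by case: eqP ir => [<-|]; rewrite ?jr ?andbT.
Qed.

End Gf.

Lemma is_genfun_bij (T T' : eqType) (w : T -> nat) (w' : T' -> nat) k
    (A : pred T) (A' : pred T') (f : T -> T') (g : T' -> T) F :
  (forall x, A x -> [/\ A' (f x), w' (f x) = (w x + k)%N & g (f x) = x]) ->
  (forall y, A' y -> A (g y) /\ f (g y) = y) ->
  is_genfun w A F -> is_genfun w' A' (fpsX ^+ k * F).
Proof.
move=> Af A'g AF n; rewrite fps_coefXnM; case: (leqP k n) => kn; last first.
  exists [::]; split=> // y; rewrite in_nil; apply/esym/negP => /andP[/A'g[Ag fg]].
  by have [_ ] := Af _ Ag; rewrite fg => -> _ /eqP; lia.
have [l [Ul lA ->]] := AF (n - k)%N; exists (map f l); split; last by rewrite size_map.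
  rewrite map_inj_in_uniq // => x y; rewrite !lA => /andP[/Af[_ _ gx] _] /andP[/Af[_ _ gy] _].
  by move=> fxy; rewrite -gx fxy gy.
move=> y; apply/mapP/andP => [[x]|[A'y /eqP wy]].
  rewrite lA => /andP[/Af[A'fx wfx _] /eqP wx] ->; split=> //.
  by apply/eqP; rewrite wfx wx subnK.
have [Agy fgy] := A'g _ A'y; exists (g y) => //; rewrite lA Agy /=.
by have [_ ] := Af _ Agy; rewrite fgy wy => -> _; rewrite addnK.
Qed.

Lemma is_genfun_genfun (A : pred (seq nat)) :
  is_genfun sumn (fun s => is_partition s && A s) (genfun A).
Proof.
move=> n; rewrite /= /num_partitions; set B := [set b | _].
pose f (b : n.-bseq 'I_n.+1) := [seq val i | i <- b].
exists [seq f b | b <- enum B]; split; last by rewrite size_map cardE.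
  rewrite map_inj_uniq ?enum_uniq // => b c /inj_map bc.
  by apply/val_inj/bc/val_inj.
move=> s; apply/mapP/andP => [[b]|[/andP[ps As] /eqP sn]].
  by rewrite mem_enum inE => /and3P[pb sb Ab] ->; rewrite pb.
have [b bs] := partition_bseq ps sn; exists b; last by rewrite -bs.
by rewrite mem_enum inE bs ps sn eqxx.
Qed.

Lemma eq_genfun (A B : pred (seq nat)) :
  (forall s, is_partition s -> A s = B s) -> genfun A = genfun B.
Proof.
move=> AB; apply: is_genfun_inj (is_genfun_genfun A) _.
apply: eq_is_genfun (is_genfun_genfun B) => s.
by case: (boolP (is_partition s)) => //= /AB.
Qed.

Lemma is_genfun_seq (T : eqType) (w : T -> nat) (l : seq T) (A : pred T) : uniq l ->
  is_genfun w (fun x => (x \in l) && A x) (\sum_(x <- l | A x) fpsX ^+ w x).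
Proof.
move=> Ul; rewrite -big_filter.
apply: (is_genfun_sum (key := id)) => [|x|x].
- exact: filter_uniq.
- by rewrite mem_filter andbC.
rewrite mem_filter => /andP[Ax xl] n; rewrite fps_coefXn.
exists (if n == w x then [:: x] else [::]); split; last by case: eqP.
  by case: ifP.
move=> y; rewrite eq_sym; case: (y =P x) => [->|yx]; last first.
  by rewrite andbF; case: ifP => _; rewrite ?in_nil // inE; apply/eqP.
by rewrite xl Ax eq_sym; case: eqP => _; rewrite ?in_nil ?mem_head.
Qed.

(** * Partitions as words of pairs and singletons *)

Definition weight (p : nat * nat) : nat := (p.1 + p.2)%N.

(** Pairs of repeating parts have even weight, pairs of consecutive parts have
    odd weight; every weight occurs once. *)
Definition pair_of (w : nat) : nat * nat := (w./2, uphalf w).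

Lemma weight_pair_of w : weight (pair_of w) = w.
Proof. by rewrite /weight /=; lia. Qed.

(** The automaton described at the top, started in the state u. *)
Fixpoint chain (u : nat) (its : seq item) : bool :=
  match its with
  | [::] => true
  | inl s :: its' => (u < s.*2)%N && chain s.*2.+2 its'
  | inr p :: its' =>
      [&& p == pair_of (weight p), (u.+1 < weight p)%N & chain (weight p) its']
  end.

Definition num_pairs : seq item -> nat := count (fun x => get_pair x : bool).
Definition num_singletons : seq item -> nat :=
  count (fun x => get_singleton x : bool).

Lemma at_most_twiceP s :
  reflect (forall x, count_mem x s <= 2)%N (at_most_twice s).
Proof.
apply: (iffP allP) => [s2 x|s2 x _]; last exact: s2.
by case: (boolP (x \in s)) => [/s2|/count_memPn->].
Qed.

Lemma count_mem_below (a x : nat) (s : seq nat) :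
  all (leq a) s -> (x < a)%N -> count_mem x s = 0%N.
Proof.
move=> /allP sa xa; apply/count_memPn/negP => /sa; lia.
Qed.

Lemma sorted_all (a : nat) (s : seq nat) : path leq a s -> all (leq a) s.
Proof. exact: (order_path_min leq_trans). Qed.

Lemma parts_of_inl s its : parts_of (inl s :: its) = s :: parts_of its.
Proof. by []. Qed.

Lemma parts_of_inr p its : parts_of (inr p :: its) = p.1 :: p.2 :: parts_of its.
Proof. by case: p. Qed.

Definition parts_ofE := (parts_of_inl, parts_of_inr).

Lemma parts_of_items s : parts_of (items s) = s.
Proof.
rewrite /parts_of; have [n sn] := ubnP (size s); elim: n s sn => // n IHn [|a [|b s]] //= sn.
case: ifP => _ /=; first by rewrite IHn //; lia.
by congr (a :: _); apply: (IHn (b :: s)).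
Qed.

(** A sequence is read after the state u exactly when prefixing the pair of
    weight u keeps it sorted with no part repeated three times.  For u = 0 the
    prefix is 0, 0, which forces the parts to be positive. *)
Definition below (u : nat) (s : seq nat) : seq nat := u./2 :: uphalf u :: s.

(** Induction along the reading of s: a pair is itself the prefix of what
    follows it, and after a singleton a the next part is at least a+2, which is
    what the prefix a+1, a+1 demands. *)
Lemma chain_items u s :
  sorted leq (below u s) -> at_most_twice (below u s) -> chain u (items s).
Proof.
have [n sn] := ubnP (size s); elim: n s sn u => // n IHn [|a s] //= sn u.
move=> /and3P[_ ua as_] /at_most_twiceP s2.
have u_a : (u < a.*2)%N by move: (s2 a) => /=; lia.
case: s as_ sn s2 => [|b s] /=; first by rewrite u_a.
move=> /andP[ab bs] sn s2; case: ifP => [ab1|/norP[ab1 ab2]] /=.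
  have pab : (a, b) = pair_of (weight (a, b)).
    by case/orP: ab1 => /eqP ->; congr pair; rewrite /weight /=; lia.
  apply/and3P; split; first by rewrite {1}pab.
    by rewrite /weight /=; move: (s2 b) => /=; case/orP: ab1 => /eqP bE; subst b; lia.
  apply: IHn; first lia.
    by move: pab; rewrite /below /pair_of => -[<- <-] /=; rewrite ab bs.
  apply/at_most_twiceP => x; move: pab (s2 x); rewrite /below /pair_of => -[<- <-] /=; lia.
rewrite u_a /=; apply: (IHn (b :: s)); rewrite /= ?bs ?andbT; [lia|lia|].
apply/at_most_twiceP => x; move: (s2 x) => /=; case: (leqP b x) => [|xb]; first lia.
by rewrite (count_mem_below (sorted_all bs) xb) => _; lia.
Qed.

(** Conversely, reading back the parts of an accepted word recovers the word,
    since the conditions prevent a singleton from pairing up with the next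
    part. *)
Lemma chain_parts_of u its : chain u its ->
  [/\ sorted leq (below u (parts_of its)), at_most_twice (below u (parts_of its))
    & items (parts_of its) = its].
Proof.
elim: its u => [|[s|[a b]] its IHits] u.
- move=> _; split=> //=; first lia.
  by apply/at_most_twiceP => x /=; case: (u./2 == x); case: (uphalf u == x).
- case/andP=> us /IHits[]; rewrite parts_of_inl.
  move: (parts_of its) => r; rewrite /below /= doubleK uphalf_double leqnn /=.
  move=> sr /at_most_twiceP r2 <-.
  have sr' : path leq s r by case: r sr {r2} => //= b r /andP[/ltnW -> ->].
  split; first by rewrite /below /= sr'; lia.
    apply/at_most_twiceP => x; move: (r2 x) => /=; case: (leqP x s) => xs; last lia.
    by rewrite (count_mem_below (sorted_all sr)); lia.
  case: r sr r2 {sr'} => //= b r /andP[sb _] r2; rewrite ifF //.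
  by apply/negbTE/negP => /orP[] /eqP bE; subst b; move: (r2 s.+1) => /=; lia.
rewrite parts_of_inr => /and3P[/eqP pab u_w /IHits[]].
move: (parts_of its) => r; move: pab u_w; rewrite /below /weight /=.
move=> -[aE bE]; rewrite -aE -bE => u_w.
move=> /andP[ab br] /at_most_twiceP r2 <-.
split; first by rewrite ab br !andbT; lia.
  apply/at_most_twiceP => x; move: (r2 x) => /=; case: (leqP a x) => ax.
    by case: (leqP b x) => bx; [lia|rewrite (count_mem_below (sorted_all br))//; lia].
  by rewrite (count_mem_below (sorted_all br)); lia.
by rewrite ifT //; lia.
Qed.

(** * The recurrence for accepted words *)

Lemma chainW u v its : (u <= v)%N -> chain v its -> chain u its.
Proof.
by case: its => [|[s|p] its] //= uv; [case/andP|case/and3P] => [??|???]; apply/andP; split; lia.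
Qed.

Lemma partition_below0 s :
  is_partition s && at_most_twice s =
  sorted leq (below 0 s) && at_most_twice (below 0 s).
Proof.
apply/andP/andP => [[/andP[ss s_gt0] /at_most_twiceP s2]|[/= s_sorted /at_most_twiceP s2]].
  split; first by case: s ss {s_gt0 s2} => //= a s ->.
  apply/at_most_twiceP => -[|x] /=; last exact: s2.
  by rewrite (count_mem_below s_gt0).
split; last by apply/at_most_twiceP => x; apply: leq_trans (s2 x) => /=; lia.
rewrite /is_partition; have /= -> := path_sorted s_sorted.
by apply/allP => -[|x] // /count_memPn; move: (s2 0%N) => /=; lia.
Qed.

Lemma chain0_partition its :
  chain 0 its -> is_partition (parts_of its) && at_most_twice (parts_of its).
Proof. by rewrite partition_below0 => /chain_parts_of[-> ->]. Qed.

Lemma partition_chain0 s : is_partition s -> at_most_twice s -> chain 0 (items s).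
Proof.
by move=> ps s2; move: (partition_below0 s); rewrite ps s2 => /esym/andP[]; apply: chain_items.
Qed.

Definition chain_class (u r n : nat) (its : seq item) : bool :=
  [&& chain u its, num_pairs its == r & num_singletons its == n].

Definition items_weight (its : seq item) : nat := sumn (parts_of its).

Definition chain_gf (u r n : nat) : fps int :=
  genfun (fun s => at_most_twice s && chain_class u r n (items s)).

(** Reading and forgetting the items are inverse bijections between the partitions
    in which each part occurs at most twice and the words accepted from 0. *)
Lemma is_genfun_items (A : pred (seq item)) :
  (forall its, A its -> chain 0 its) ->
  is_genfun items_weight A (genfun (fun s => at_most_twice s && A (items s))).
Proof.
move=> A0; rewrite -[genfun _]mul1r -(expr0 fpsX).
apply: (is_genfun_bij (f := items) (g := parts_of) _ _ (is_genfun_genfun _))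
  => [s /and3P[_ _ As]|its Aits].
  by split=> //; [rewrite addn0 /items_weight parts_of_items|exact: parts_of_items].
have [_ _ itsK] := chain_parts_of (A0 _ Aits); rewrite itsK Aits andbT.
by have /andP[-> ->] := chain0_partition (A0 _ Aits).
Qed.

Lemma chain_gfP u r n : is_genfun items_weight (chain_class u r n) (chain_gf u r n).
Proof. by apply: is_genfun_items => its /and3P[uits _ _]; apply: chainW uits. Qed.

Definition at_pred (F : nat -> fps int) (n : nat) : fps int :=
  if n is n'.+1 then F n' else 0.

(** The words accepted from u but not from u+1 begin with a pair of weight
    exactly u+2, or with a singleton s such that 2s = u+1; what follows is
    accepted from u+2, respectively from 2s+2 = u+3. *)
Lemma chain_gf_step u r n :
  chain_gf u r n =
  chain_gf u.+1 r n + fpsX ^+ u.+2 * at_pred (fun r' => chain_gf u.+2 r' n) r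
  + (if odd u then fpsX ^+ uphalf u * at_pred (chain_gf u.+3 r) n else 0).
Proof.
pose A its := if its is inr p :: its' then
  [&& p == pair_of u.+2, chain u.+2 its', (num_pairs its').+1 == r
    & num_singletons its' == n] else false.
pose B its := if its is inl s :: its' then
  [&& u.+1 == s.*2, chain u.+3 its', num_pairs its' == r
    & (num_singletons its').+1 == n] else false.
have AP : is_genfun items_weight A
    (fpsX ^+ u.+2 * at_pred (fun r' => chain_gf u.+2 r' n) r).
  case: r @A @B => [|r] A _ /=.
    by rewrite mulr0; apply: is_genfun0 => -[|[s|p] its] //=; rewrite !andbF.
  apply: (is_genfun_bij (f := cons (inr (pair_of u.+2))) (g := behead)
     _ _ (chain_gfP u.+2 r n)) => [its|[|[s|p] its] //=].
    case/and3P=> cits rits nits; split=> //; first by rewrite /A cits eqSS rits nits eqxx.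
    by rewrite /items_weight parts_of_inr /=; lia.
  by case/and4P => /eqP -> cits rits nits; rewrite /chain_class cits nits -eqSS rits.
have BP : is_genfun items_weight B
    (if odd u then fpsX ^+ uphalf u * at_pred (chain_gf u.+3 r) n else 0).
  case: ifP => ou; last by apply: is_genfun0 => -[|[s|p] its] //=; apply/negP => /andP[]; lia.
  case: n {A AP} @B => [|n] B /=.
    by rewrite mulr0; apply: is_genfun0 => -[|[s|p] its] //=; rewrite !andbF.
  apply: (is_genfun_bij (f := cons (inl (uphalf u))) (g := behead)
     _ _ (chain_gfP u.+3 r n)) => [its|[|[s|p] its] //=].
    case/and3P=> cits rits nits; split=> //.
      by rewrite /B cits eqSS rits nits !andbT; lia.
    by rewrite /items_weight parts_of_inl /=; lia.
  case/and4P => us cits rits nits; rewrite /chain_class cits rits -eqSS nits; split=> //.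
  by congr (inl _ :: _); lia.
apply: is_genfun_inj (chain_gfP u r n) _.
have AB its : (chain_class u.+1 r n its || A its) || B its = chain_class u r n its.
  rewrite /A /B /chain_class; case: its => [|[s|p] its] /=; rewrite ?orbF //.
    rewrite add0n add1n.
    case: (ltngtP u.+1 s.*2) => us /=; rewrite ?orbF //.
    by rewrite -us.
  rewrite add0n add1n.
  case: (ltngtP u.+2 (weight p)) => uw /=; rewrite ?andbF //=.
  - by case: (p =P pair_of u.+2) uw => [->|]; rewrite ?orbF // weight_pair_of ltnn.
  - by case: (p =P pair_of u.+2) uw => [->|]; rewrite // weight_pair_of ltnn.
  by rewrite -uw -!andbA.
apply: (eq_is_genfun AB); apply: is_genfunU BP; last first.
  apply: is_genfunU AP; last exact: chain_gfP.
  case=> [|[s|p] its] //= /and3P[/and3P[_ uw _] _ _].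
  by apply/negP => /and4P[/eqP pE]; rewrite pE weight_pair_of ltnn in uw.
case=> [|[s|p] its] //=; rewrite orbF => /and3P[/andP[us _] _ _].
by apply/negP => /and4P[/eqP]; lia.
Qed.

(** * Moving all pairs or all singletons once *)

Lemma chain_gf_small u r n k :
  (0 < r + n)%N -> (k.*2 < u)%N -> fps_coef (chain_gf u r n) k = 0.
Proof.
move=> rn ku; have [l [_ lP ->]] := chain_gfP u r n k.
case: l lP => // its l /(_ its); rewrite mem_head => /esym/andP[/and3P[uits rE nE] /eqP].
case: its uits rE nE => [|[s|p] its] /=; rewrite /items_weight ?parts_ofE /=.
- by move=> _ /eqP r0 /eqP n0; lia.
- by move=> /andP[us _] _ _ ?; lia.
by case/and3P => _; rewrite /weight => ? _ _ _ ?; lia.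
Qed.

Lemma chain_gf00 u : chain_gf u 0 0 = 1.
Proof.
apply: is_genfun_inj (chain_gfP u 0 0) _ => k.
exists (if k is 0%N then [:: [::]] else [::]); split; last by case: k.
  by case: k.
move=> its; rewrite (_ : (its \in _) = (its == [::]) && (k == 0%N)); last first.
  by case: k => [|k]; rewrite ?in_nil ?andbF // inE andbT.
by case: its => [|[s|p] its]; rewrite /chain_class /= ?andbF.
Qed.

(** For differences of series of words accepted from a growing state: such words
    have ever larger weights. *)
Lemma fps_stable_eq0 (D : nat -> fps int) :
  (forall k, D k = D k.+1) ->
  (forall k n, (n < k)%N -> fps_coef (D k) n = 0) -> forall k, D k = 0.
Proof.
move=> Dstep D0 k; apply: fpsP => n.
have DE j : D k = D (k + j)%N by elim: j => [|j ->]; rewrite ?addn0 // addnS -Dstep.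
by rewrite (DE n.+1) D0 //; lia.
Qed.

Section Recurrences.
Implicit Types (k r n : nat).
Notation g := chain_gf.
Notation x := (fpsX : fps int).

Let step_even k r n :
  g k.*2 r n = g k.*2.+1 r n
  + x ^+ 2 * (x ^+ k) ^+ 2 * at_pred (fun r' => g k.*2.+2 r' n) r.
Proof.
rewrite chain_gf_step odd_double addr0 -exprM -exprD; congr (_ + x ^+ _ * _); lia.
Qed.

Let step_odd k r n :
  g k.*2.+1 r n = g k.*2.+2 r n
  + x ^+ 3 * (x ^+ k) ^+ 2 * at_pred (fun r' => g k.*2.+3 r' n) r
  + x * x ^+ k * at_pred (g k.*2.+4 r) n.
Proof.
rewrite chain_gf_step /= odd_double -exprM -exprD -exprS.
by congr (_ + x ^+ _ * _ + x ^+ _ * _); lia.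
Qed.

(** These two reduce an identity modulo hypotheses to a ring identity; in the
    proofs below the multiplier of an induction hypothesis is the coefficient of
    the words lost in one step of the recurrence. *)
Let lin1 (a b p q c : fps int) : p = q -> a - b = c * (p - q) -> a = b.
Proof. by move=> ->; rewrite subrr mulr0 => /eqP; rewrite subr_eq0 => /eqP. Qed.

Let lin2 (a b p q c p' q' c' : fps int) : p = q -> p' = q' ->
  a - b = c * (p - q) + c' * (p' - q') -> a = b.
Proof. by move=> -> ->; rewrite !subrr !mulr0 addr0 => /eqP; rewrite subr_eq0 => /eqP. Qed.

(** Without pairs, adding 1 to each of the n singletons changes the lower bound
    of the first one by 1, that is, the state by 2. *)
Lemma chain_gf_shift_singletons n k :
  x ^+ n * g k.*2 0 n = g k.*2.+2 0 n.
Proof.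
elim: n k => [|n IHn] k; first by rewrite !chain_gf00 mulr1.
apply/eqP; rewrite -subr_eq0; apply/eqP.
apply: (fps_stable_eq0 (D := fun k => x ^+ n.+1 * g k.*2 0 n.+1 - g k.*2.+2 0 n.+1)).
  move=> {}k; rewrite step_even step_odd.
  have := step_even k.+1 0 n.+1; rewrite doubleS /= mulr0 addr0 => ->.
  have := step_odd k.+1 0 n.+1; rewrite doubleS /= mulr0 addr0 => ->.
  have := IHn k.+2; rewrite !doubleS => IH.
  apply: (lin1 (c := x * x * x ^+ k) IH); rewrite !exprS /=; ring.
move=> {}k m mk; rewrite fps_coefB fps_coefXnM !chain_gf_small ?subr0 //; try lia.
by case: ifP.
Qed.

Let exp3S r : x ^+ (3 * r.+1) = x ^+ 3 * x ^+ (3 * r).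
Proof. by rewrite mulnS exprD. Qed.

(** In [even_eq] and [odd_eq] the right-hand sides enumerate the words whose
    first pair can be moved back.  From the state u = 2k these are the words
    accepted from u+3, and the singleton k+1 followed by any word accepted from
    2k+4.  From u = 2k+1 they are the words accepted from u+3, the singleton k+1
    followed by a word that is accepted from 2k+4 and does not begin with the
    pair of weight 2k+6 (which would complete a block), and the singleton k+2
    followed by any word accepted from 2k+6. *)
Let even_eq r n k := x ^+ (3 * r) * g k.*2 r n =
  g k.*2.+3 r n + x * x ^+ k * at_pred (g k.*2.+4 r) n.

Let odd_eq r n k := x ^+ (3 * r) * g k.*2.+1 r n =
  g k.*2.+4 r n + x * x ^+ k * at_pred (g k.*2.+1.+4 r) n
  + x ^+ 2 * x ^+ k * at_pred (g k.*2.+2.+4 r) n.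

Let even_diff r n k := x ^+ (3 * r) * g k.*2 r n -
  (g k.*2.+3 r n + x * x ^+ k * at_pred (g k.*2.+4 r) n).

Let odd_diff r n k := x ^+ (3 * r) * g k.*2.+1 r n -
  (g k.*2.+4 r n + x * x ^+ k * at_pred (g k.*2.+1.+4 r) n
  + x ^+ 2 * x ^+ k * at_pred (g k.*2.+2.+4 r) n).

(** Without pairs there is nothing to move, and the right-hand sides merely sort
    the words by their first singleton. *)
Let no_pairs_eq n k : even_eq 0 n k /\ odd_eq 0 n k.
Proof.
have E j : g j.*2 0 n = g j.*2.+1 0 n by rewrite step_even /= mulr0 addr0.
have O j : g j.*2.+1 0 n = g j.*2.+2 0 n + x * x ^+ j * at_pred (g j.*2.+4 0) n.
  by rewrite step_odd /= mulr0 addr0.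
have E1 := E k.+1; have O1 := O k.+1; rewrite !doubleS in E1 O1.
rewrite /even_eq /odd_eq muln0 mul1r mul1r E O E1; split=> //.
have -> : at_pred (g k.*2.+4 0) n = at_pred (g k.*2.+1.+4 0) n.
  case: n {E O E1 O1} => //= n.
  by have := step_even k.+2 0 n; rewrite !doubleS /= mulr0 addr0.
by rewrite O1 exprS; ring.
Qed.

(** The words lost on the left from 2k to 2k+1 begin with a pair of weight
    2k+2; moving back the pairs of the rest is the statement for one pair less. *)
Let even_odd_diff r n k :
  (forall j, even_eq r n j) -> even_diff r.+1 n k = odd_diff r.+1 n k.
Proof.
move=> /(_ k.+1); rewrite /even_eq /even_diff /odd_diff doubleS => IH.
have := step_odd k.+1 r.+1 n; rewrite doubleS => ->.
rewrite step_even exp3S; case: n IH => [|n] /= IH.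
  by apply: (lin1 (c := x ^+ 5 * (x ^+ k) ^+ 2) IH); rewrite !exprS; ring.
have := step_even k.+2 r.+1 n; rewrite !doubleS /= => ->.
apply: (lin1 (c := x ^+ 5 * (x ^+ k) ^+ 2) IH); rewrite !exprS; ring.
Qed.

(** From 2k+1 to 2k+2 also the words beginning with the singleton k+1 are
    lost; moving back their pairs is the statement for one singleton less. *)
Let odd_even_diff r n k :
  (forall n j, odd_eq r n j) -> (forall n' j, n = n'.+1 -> even_eq r.+1 n' j) ->
  odd_diff r.+1 n k = even_diff r.+1 n k.+1.
Proof.
move=> /(_ n k.+1); rewrite /odd_eq /even_eq /even_diff /odd_diff !doubleS => IHr IHn.
rewrite step_odd.
have := step_even k.+2 r.+1 n; rewrite !doubleS => ->.
case: n IHr IHn => [|n] /= IHr IHn.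
  rewrite exp3S.
  apply: (lin1 (c := x ^+ 6 * (x ^+ k) ^+ 2) IHr); rewrite !exprS; ring.
have := step_odd k.+2 r.+1 n; rewrite !doubleS => ->.
have := step_even k.+3 r.+1 n; rewrite !doubleS => ->.
have := IHn n k.+2 erefl; rewrite !doubleS => {}IHn.
apply: (lin2 (c := x ^+ 6 * (x ^+ k) ^+ 2) (c' := x * x ^+ k) IHr IHn).
rewrite exp3S !exprS /=; ring.
Qed.

(** Combining the two preceding steps, the difference of the two sides is
    independent of k, and it vanishes in the limit. *)
Lemma chain_gf_shift_pairs r n k : even_eq r n k /\ odd_eq r n k.
Proof.
elim: r n k => [|r IHr] n k; first exact: no_pairs_eq.
have even_odd m j : even_diff r.+1 m j = odd_diff r.+1 m j.
  by apply: even_odd_diff => i; case: (IHr m i).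
suff even : forall k, even_diff r.+1 n k = 0.
  by split; apply/eqP; rewrite -subr_eq0; apply/eqP; [exact: even|rewrite -[LHS]even_odd].
elim: n {k} => [|n IHn] k; apply: (fps_stable_eq0 (D := even_diff _ _)) => {}k.
- by rewrite even_odd; apply: odd_even_diff => // m j; case: (IHr m j).
- move=> m km; rewrite /even_diff [at_pred _ _]/= mulr0 addr0 fps_coefB fps_coefXnM.
  rewrite !chain_gf_small; try lia.
  by case: ifP.
- rewrite even_odd; apply: odd_even_diff => [m j|m j [<-]]; first by case: (IHr m j).
  by apply/eqP; rewrite -subr_eq0; apply/eqP; exact: IHn.
move=> m km; rewrite /even_diff fps_coefB fps_coefD fps_coefXnM -mulrA fps_coefXM.
rewrite !chain_gf_small; try lia.
case: m km => [|m] km; rewrite ?fps_coefXnM ?chain_gf_small; try lia.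
all: by do ?case: ifP.
Qed.

(** Subtracting q^n times the series leaves the words whose first singleton is
    as small as possible, and they are counted by the case n - 1. *)
Lemma chain_gf_singletons n u :
  qpoch x x n * g u 0 n = x ^+ (u./2 * n + n ^ 2).
Proof.
elim: n u => [|n IHn] u; first by rewrite /qpoch big_ord0 chain_gf00 mulr1 muln0.
have first_singleton : (1 - x ^+ n.+1) * g u 0 n.+1 = x ^+ u./2.+1 * g u./2.*2.+4 0 n.
  have E k : g k.*2 0 n.+1 = g k.*2.+1 0 n.+1 by rewrite step_even /= mulr0 addr0.
  have -> : g u 0 n.+1 = g u./2.*2 0 n.+1.
    by rewrite -{1}[u]odd_double_half; case: odd => //=; rewrite add1n -E.
  move: u./2 => k; rewrite mulrBl mul1r chain_gf_shift_singletons E step_odd /=.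
  by rewrite !exprS; ring.
rewrite /qpoch big_ord_recr /= -exprS -mulrA first_singleton mulrCA.
by rewrite -/(qpoch x x n) IHn /= doubleK -exprD; congr (x ^+ _); nia.
Qed.

(** The first three terms come from the recurrence applied at u, u+1 and u+2,
    the last one from the blocks excluded in [odd_eq]. *)
Lemma chain_gf_frozen_pair r n u :
  (1 - x ^+ (3 * r.+1)) * g u r.+1 n =
    x ^+ u.+2 * g u.+2 r n + x ^+ u.+3 * g u.+3 r n + x ^+ u.+4 * g u.+4 r n
    + (if odd u then x ^+ (uphalf u + (u + 5)) * at_pred (g (u + 5) r) n else 0).
Proof.
have xE k : x ^+ k.*2 = (x ^+ k) ^+ 2 by rewrite -exprM muln2.
rewrite mulrBl mul1r.
rewrite -[u]odd_double_half; move: u./2 => k; case: odd => /=; rewrite ?add0n ?add1n; last first.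
  have [-> _] := chain_gf_shift_pairs r.+1 n k.
  have := step_even k.+1 r.+1 n; rewrite doubleS step_even step_odd => -> /=.
  rewrite odd_double addr0 !exprS !xE; ring.
have [_ ->] := chain_gf_shift_pairs r.+1 n k.
have := step_odd k.+1 r.+1 n; rewrite doubleS /= => O.
have := step_even k.+1 r.+1 n; rewrite doubleS step_odd O => -> /=.
rewrite odd_double /= doubleK.
have -> : at_pred (g k.*2.+4 r.+1) n = at_pred (g k.*2.+1.+4 r.+1) n
  + x ^+ 6 * (x ^+ k) ^+ 2 * at_pred (g k.*2.+2.+4 r) n.
  case: n {O} => [|n] /=; first ring.
  by have := step_even k.+2 r.+1 n; rewrite !doubleS /= !exprS => ->; ring.
have -> : (k.*2.+1 + 5 = k.*2.+2.+4)%N by lia.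
rewrite (_ : k.+1 + k.*2.+2.+4 = k + k.*2.+3.+4)%N ?(exprD _ k); last lia.
rewrite !exprS !xE.
ring.
Qed.

End Recurrences.

(** * Words in which every pair is frozen *)

Definition chain_state (u : nat) (its : seq item) : nat :=
  foldl (fun v x => match x with inl s => s.*2.+2 | inr p => weight p end) u its.

(** A frozen pair that follows a pair of weight u has weight u+2, u+3 or u+4, or
    it has weight u+5 and is separated from the former by the singleton
    (u+1)/2: a block. *)
Fixpoint packed (u : nat) (its : seq item) : bool :=
  match its with
  | [::] => true
  | inr p :: its' =>
      (p \in [:: pair_of u.+2; pair_of u.+3; pair_of u.+4]) && packed (weight p) its'
  | inl s :: inr p :: its' =>
      [&& s.*2 == u.+1, p == pair_of (u + 5) & packed (u + 5) its']
  | _ => false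
  end.

Fixpoint packed_seqs (r u : nat) : seq (seq item) :=
  if r is r'.+1 then
    [seq inr (pair_of u.+2) :: its | its <- packed_seqs r' u.+2] ++
    [seq inr (pair_of u.+3) :: its | its <- packed_seqs r' u.+3] ++
    [seq inr (pair_of u.+4) :: its | its <- packed_seqs r' u.+4] ++
    (if odd u then
       [seq [:: inl (uphalf u), inr (pair_of (u + 5)) & its]
       | its <- packed_seqs r' (u + 5)]
     else [::])
  else [:: [::]].

(** Induction along the two productions of [packed]: one pair, or a singleton
    together with the pair that ends a block. *)
Lemma packed_ind (Q : nat -> seq item -> Prop) :
  (forall u, Q u [::]) ->
  (forall u p its, p = pair_of (weight p) -> (u.+2 <= weight p <= u.+4)%N ->
     packed (weight p) its -> Q (weight p) its -> Q u (inr p :: its)) ->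
  (forall u s its, s.*2 = u.+1 -> packed (u + 5) its -> Q (u + 5)%N its ->
     Q u [:: inl s, inr (pair_of (u + 5)) & its]) ->
  forall u its, packed u its -> Q u its.
Proof.
move=> Q0 Qp Qb u its; have [n] := ubnP (size its).
elim: n its u => // n IHn [|[s|p] its] u //=; last first.
  rewrite !inE ltnS => itsn /andP[pw pits].
  apply: Qp pits (IHn _ _ itsn pits).
    by case/or3P: pw => /eqP ->; rewrite weight_pair_of.
  by case/or3P: pw => /eqP ->; rewrite weight_pair_of; lia.
case: its => [|[//|p] its] //= itsn /and3P[/eqP us /eqP -> pits].
by apply: Qb us pits (IHn _ _ _ pits); lia.
Qed.

Lemma packed_chain u its : packed u its -> chain u its.
Proof.
move: u its; apply: packed_ind => //= [u p its <- uw _ ->|u s its us _ uits].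
  by rewrite eqxx /=; lia.
by rewrite weight_pair_of eqxx uits; lia.
Qed.

Lemma packed_seqsP r u its :
  reflect (packed u its /\ num_pairs its = r) (its \in packed_seqs r u).
Proof.
apply: (iffP idP) => [|[uits <-]].
  elim: r u its => [|r IHr] u its /=; first by rewrite inE => /eqP ->.
  rewrite !mem_cat => /or4P[] => [/mapP[L]|/mapP[L]|/mapP[L]|];
    try by move=> /IHr[pL nL] ->; rewrite /= add1n nL weight_pair_of pL !inE eqxx ?orbT.
  case: ifP => // ou /mapP[L /IHr[pL nL] ->]; rewrite /= add0n add1n nL pL eqxx.
  by split=> //; rewrite !andbT; lia.
move: u its uits; apply: packed_ind => [u|u p its pE uw _ IH|u s its us _ IH].
- exact: mem_head.
- have M w : weight p = w ->
      inr p :: its \in [seq inr (pair_of w) :: L | L <- packed_seqs (num_pairs its) w].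
    by move=> <-; apply/mapP; exists its; rewrite // -pE.
  rewrite /= add0n !mem_cat.
  have /or3P : [|| weight p == u.+2, weight p == u.+3 | weight p == u.+4] by lia.
  by case=> /eqP /M ->; rewrite ?orbT.
rewrite /= add0n !mem_cat (_ : odd u); last lia.
apply/or4P/Or44/mapP; exists its => //; congr [:: inl _, _ & _]; lia.
Qed.

Lemma uniq_packed_seqs r u : uniq (packed_seqs r u).
Proof.
elim: r u => //= r IHr u.
have Umap w v : uniq [seq inr (pair_of w) :: its | its <- packed_seqs r v : seq (seq item)].
  by rewrite map_inj_uniq // => L L' [].
have pairN v w (l m : seq (seq item)) : v != w -> ~~ has (mem [seq inr (pair_of v) :: L | L <- l])
    [seq inr (pair_of w) :: L | L <- m].
  move=> vw; apply/hasPn => _ /mapP[L _ ->]; apply/negP => /mapP[L' _ [hw uw _]].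
  by move: vw; lia.
have blockN v (l : seq (seq item)) : ~~ has (mem [seq inr (pair_of v) :: L | L <- l])
    (if odd u then [seq [:: inl (uphalf u), inr (pair_of (u + 5)) & its]
       | its <- packed_seqs r (u + 5)] else [::]).
  by case: ifP => // _; apply/hasPn => _ /mapP[L _ ->]; apply/negP => /mapP[L' _ []].
rewrite !cat_uniq !Umap !has_cat !negb_or !pairN ?blockN ?andbT /=; try lia.
by case: ifP => // _; rewrite map_inj_uniq // => L L' [].
Qed.

(** Iteration of [chain_gf_frozen_pair], until only singletons that follow the
    last frozen pair are left. *)
Lemma packed_sum r n u :
  qpoch (fpsX ^+ 3) (fpsX ^+ 3) r * chain_gf u r n =
  \sum_(its <- packed_seqs r u | (num_singletons its <= n)%N)
     fpsX ^+ items_weight its *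
     chain_gf (chain_state u its) 0 (n - num_singletons its).
Proof.
elim: r n u => [|r IHr] n u.
  by rewrite /qpoch big_ord0 mul1r big_cons big_nil /= addr0 mul1r subn0.
rewrite /qpoch big_ord_recr /= -exprM -exprD (_ : (3 + 3 * r = 3 * r.+1)%N); last lia.
rewrite -/(qpoch _ _ r) -mulrA chain_gf_frozen_pair !mulrDr !big_cat !big_map /= !addrA.
have pair_sum w :
    qpoch (fpsX ^+ 3) (fpsX ^+ 3) r * (fpsX ^+ w * chain_gf w r n) =
    \sum_(its <- packed_seqs r w | (0 + num_singletons its <= n)%N)
      fpsX ^+ items_weight (inr (pair_of w) :: its) *
      chain_gf (chain_state (weight (pair_of w)) its) 0 (n - (0 + num_singletons its)).
  rewrite mulrCA IHr big_distrr /=; apply: eq_bigr => its _.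
  rewrite weight_pair_of add0n mulrA -exprD; congr (fpsX ^+ _ * _).
  by rewrite /items_weight parts_of_inr /=; lia.
rewrite -!pair_sum {pair_sum}; congr (_ + _).
case: ifP => ou; last by rewrite big_nil mulr0.
rewrite big_map; case: n => [|n] /=; first by rewrite !mulr0 big_pred0.
rewrite mulrCA IHr big_distrr /=; apply: eq_big => [its|its _]; first by rewrite add1n ltnS.
rewrite weight_pair_of !add0n add1n subSS mulrA -exprD; congr (fpsX ^+ _ * _).
by rewrite /items_weight parts_of_inl parts_of_inr /=; lia.
Qed.

(** * Backward moves and base partitions *)

Lemma parts_of_cat L M : parts_of (L ++ M) = parts_of L ++ parts_of M.
Proof. by rewrite /parts_of map_cat flatten_cat. Qed.

Lemma chain_state_rcons u L x :
  chain_state u (rcons L x) = match x with inl s => s.*2.+2 | inr p => weight p end.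
Proof. by rewrite /chain_state -cats1 foldl_cat. Qed.

Lemma chain_cat u L M : chain u (L ++ M) = chain u L && chain (chain_state u L) M.
Proof. by elim: L u => [|[s|p] L IHL] u //=; rewrite IHL !andbA. Qed.

Lemma last_pair_rcons L x :
  last_pair (rcons L x) = if x is inr p then p else last_pair L.
Proof.
rewrite /last_pair -cats1 pmap_cat; case: x => [s|p] /=; first by rewrite cats0.
by rewrite last_cat.
Qed.

(** The state bounds the weight of the last pair read, which is what the
    condition of not passing through the preceding pair requires. *)
Lemma last_pair_chain_state L : chain 0 L ->
  last_pair L = pair_of (weight (last_pair L)) /\
  (weight (last_pair L) <= chain_state 0 L)%N.
Proof.
elim/last_ind: L => [|L x IHL] //; rewrite -cats1 chain_cat cats1 => /andP[/IHL[pE wL]].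
rewrite last_pair_rcons chain_state_rcons; case: x => [s|p] /=.
  by rewrite andbT => sL; split=> //; lia.
by case/and3P => /eqP.
Qed.

(** The truncated subtractions agree even where the moved pair would have to
    contain a negative number. *)
Lemma move_backE p : p = pair_of (weight p) -> move_back p = pair_of (weight p - 3).
Proof.
case: p => a b; rewrite /weight /move_back /pair_of /= => -[aE bE].
by case: eqP => [ab|ab]; congr pair; lia.
Qed.

Lemma can_move_backE L p M :
  can_move_back (L ++ inr p :: M) (size L) =
  let s := parts_of (L ++ inr (move_back p) :: M) in
  [&& all (leq 1) s, at_most_twice s & ((last_pair L).2 <= (move_back p).1)%N].
Proof.
rewrite /can_move_back nth_cat ltnn subnn /= take_size_cat // drop_cat ifN; last by rewrite -leqNgt.
rewrite subSn // subnn /= drop0; set s := parts_of _.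
have ps : perm_eq (sort leq s) s by rewrite perm_sort.
rewrite (perm_all _ ps) /at_most_twice (perm_all _ ps).
by congr [&& _, _ & _]; apply: eq_all => x; rewrite (permP ps).
Qed.

(** The moved parts need not be read as the moved items: it suffices that some
    accepted word L' has the same parts. *)
Lemma can_move_back_chain L p M L' : chain 0 L' ->
  parts_of L' = parts_of (L ++ inr (move_back p) :: M) ->
  ((last_pair L).2 <= (move_back p).1)%N -> can_move_back (L ++ inr p :: M) (size L).
Proof.
move=> /chain0_partition /andP[/andP[_ s1] s2] sE lp.
by rewrite can_move_backE /= -sE s1 s2 lp.
Qed.

(** Here the moved pair keeps its place in the word. *)
Lemma can_move_back_far L p M : chain 0 (L ++ inr p :: M) ->
  (chain_state 0 L + 5 <= weight p)%N -> can_move_back (L ++ inr p :: M) (size L).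
Proof.
rewrite chain_cat /= => /and4P[cL /eqP pE up cM] far.
apply: can_move_back_chain (erefl _) _; rewrite move_backE //.
  rewrite chain_cat cL /= weight_pair_of eqxx (chainW _ cM) ?andbT /=; lia.
by have [-> ] := last_pair_chain_state cL; rewrite weight_pair_of /pair_of /=; lia.
Qed.

(** A pair preceded by the singleton s has weight at least 2s+4.  For the weights
    2s+4, 2s+5 and 2s+6 the moved pair passes s and is read before a larger
    singleton; this fails only if that pair would overlap with a preceding pair
    of weight 2s-1, that is, inside a block. *)
Lemma can_move_back_across L s p M : chain 0 (rcons L (inl s) ++ inr p :: M) ->
  (weight p == s.*2.+4 -> s.*2 != (chain_state 0 L).+1) ->
  can_move_back (rcons L (inl s) ++ inr p :: M) (size (rcons L (inl s))).
Proof.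
move=> cLpM; case: (leqP (s.*2 + 7) (weight p)) => [far _|near blocked].
  by apply: can_move_back_far; rewrite // chain_state_rcons; lia.
move: cLpM; rewrite chain_cat chain_state_rcons -cats1 chain_cat /= !andbT.
case/and4P=> /andP[cL us] /eqP pE sp cM.
(* s, [s,s+1] is read as [s,s], s+1; s, [s+1,s+1] as [s,s+1], s+1; and
   s, [s+1,s+2] as [s,s+1], s+2. *)
pose w := (s.*2 + (weight p != s.*2.+4))%N; pose s' := (s.+1 + (weight p == s.*2 + 6))%N.
apply: (can_move_back_chain (L' := L ++ [:: inr (pair_of w), inl s' & M])).
- rewrite chain_cat cL /= weight_pair_of eqxx (chainW _ cM) ?andbT /w /s' /=; lia.
- rewrite !parts_of_cat move_backE // !(parts_of_inl, parts_of_inr) -catA /=.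
  by congr (_ ++ [:: _, _, _ & _]); rewrite /w /s'; lia.
rewrite move_backE // cats1 last_pair_rcons.
by have [-> ] := last_pair_chain_state cL; rewrite weight_pair_of /pair_of /=; lia.
Qed.

(** The state 0 at the beginning of a word plays the role of a pair of
    weight 0. *)
Definition ends_at (u : nat) (L : seq item) : Prop :=
  (L = [::] /\ u = 0%N) \/ exists L', L = rcons L' (inr (pair_of u)).

Lemma not_at_most_twice d s : (2 < count_mem d s)%N -> ~~ at_most_twice s.
Proof. by move=> sd; apply/at_most_twiceP => /(_ d); lia. Qed.

(** The moved pair contains 0, or it passes through the preceding pair, or it
    repeats the larger part d of the preceding pair three times. *)
Lemma frozen_pair u L p M : ends_at u L -> p = pair_of (weight p) ->
  (u.+2 <= weight p <= u.+4)%N -> ~~ can_move_back (L ++ inr p :: M) (size L).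
Proof.
move=> uL pE up; rewrite can_move_backE move_backE //; apply/negP => /and3P[].
case: uL => [[-> u0]|[L' ->]]; first by rewrite parts_of_inr /=; lia.
rewrite last_pair_rcons parts_of_cat -cats1 parts_of_cat !parts_of_inr => _ L2 /= lp.
suff : ~~ at_most_twice ((parts_of L' ++ [:: u./2; uphalf u]) ++
   (weight p - 3)./2 :: uphalf (weight p - 3) :: parts_of M) by rewrite L2.
by apply: (@not_at_most_twice (uphalf u)); rewrite !count_cat /=; lia.
Qed.

(** Moving back the last pair of the block [s-1,s], s, [s+2,s+2] produces a third
    part s. *)
Lemma frozen_block u L s M : ends_at u L -> s.*2 = u.+1 ->
  ~~ can_move_back (rcons L (inl s) ++ inr (pair_of (u + 5)) :: M) (size (rcons L (inl s))).
Proof.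
move=> [[_ ->]|[L' ->]] us; first lia.
rewrite can_move_backE move_backE ?weight_pair_of //; apply/negP => /and3P[_ L2 _].
move: L2; apply/negP/(@not_at_most_twice s).
rewrite !parts_of_cat -!cats1 !parts_of_cat !parts_ofE /= !count_cat /=; lia.
Qed.

Lemma packed_frozen u M : packed u M -> forall L, ends_at u L ->
  all (fun i => ~~ can_move_back (L ++ M) i) (iota (size L) (size M)).
Proof.
move: u M; apply: packed_ind => // [u p M pE up _ IH|u s M us _ IH] L uL.
  rewrite /= (frozen_pair _ uL) //= -cat_rcons -(size_rcons L (inr p)); apply: IH.
  by right; exists L; rewrite -pE.
have -> : L ++ [:: inl s, inr (pair_of (u + 5)) & M] =
    rcons L (inl s) ++ inr (pair_of (u + 5)) :: M by rewrite cat_rcons.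
rewrite /= {1}/can_move_back cat_rcons nth_cat ltnn subnn /= -cat_rcons.
rewrite -(size_rcons L (inl s)) (frozen_block _ uL) //= -cat_rcons.
rewrite -(size_rcons (rcons _ _) (inr (pair_of (u + 5)))).
by apply: IH; right; exists (rcons L (inl s)).
Qed.

(** This holds for the empty word, which has no moveable singletons either. *)
Definition ends_with_pair (L : seq item) : bool :=
  get_pair (last (inr (0, 0)%N) L).

Lemma moveable_nil L : (moveable L == [::]) = ends_with_pair L.
Proof.
case/lastP: L => // L x; rewrite /moveable /ends_with_pair last_rcons rev_rcons size_rcons.
case: x => [s|p] /=; last by rewrite subn0 -(size_rcons L (inr p)) drop_size.
rewrite subSS drop_rcons ?leq_subr // -cats1 pmap_cat /=.
by case: pmap.
Qed.

(** After a singleton the state is even, so that the singleton s cannot be in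
    the middle of a block, and the next pair is free to move. *)
Lemma movable_after_singletons s L M :
  ~~ odd (chain_state 0 L) -> chain 0 (L ++ inl s :: M) -> ends_with_pair (inl s :: M) ->
  has (can_move_back (L ++ inl s :: M)) (iota (size L) (size M).+1).
Proof.
elim: M s L => [|[s'|p] M IHM] s L // oddL cLM ends.
  rewrite -cat_rcons in cLM *.
  have := IHM s' (rcons L (inl s)); rewrite chain_state_rcons /= odd_double size_rcons.
  by move=> /(_ isT cLM ends) ->; rewrite orbT.
rewrite -cat_rcons in cLM *; apply/hasP; exists (size (rcons L (inl s))).
  by rewrite mem_iota size_rcons /=; lia.
by apply: can_move_back_across => // _; lia.
Qed.

(** Reading M item by item: a pair that cannot be moved back is close to the
    preceding pair or ends a block, and two successive singletons before a pair
    would let that pair move. *)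
Lemma frozen_packed L M : chain 0 (L ++ M) -> (M = [::] \/ ends_with_pair M) ->
  all (fun i => ~~ can_move_back (L ++ M) i) (iota (size L) (size M)) ->
  packed (chain_state 0 L) M.
Proof.
have [n] := ubnP (size M); elim: n M L => // n IHn [//|[s|p] M] L /= Mn cLM ends.
  case: M Mn cLM ends => [|[s'|p] M] /= Mn cLM ends; first by case: ends.
    move=> unmoved; exfalso.
    have frozen i : i \in iota (size L) (size M).+2 ->
        ~~ can_move_back (L ++ [:: inl s, inl s' & M]) i by move: i; apply/allP.
    have ends' : ends_with_pair (inl s' :: M) by case: ends.
    move: (cLM); rewrite -cat_rcons => cLM'.
    have even_state : ~~ odd (chain_state 0 (rcons L (inl s))).
      by rewrite chain_state_rcons /= odd_double.
    have /hasP[i] := movable_after_singletons even_state cLM' ends'.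
    rewrite cat_rcons size_rcons => iL; apply/negP; apply: frozen.
    by move: iL; rewrite !mem_iota; lia.
  case/and3P => _; move: (cLM); rewrite -cat_rcons -(size_rcons L (inl s)) => cLM' unmoved.
  have blocked : (weight p == s.*2.+4) && (s.*2 == (chain_state 0 L).+1).
    apply/negP => /negP; rewrite negb_and => free.
    case/negP: unmoved; apply: can_move_back_across => // pw.
    by move: free; rewrite pw.
  have /andP[/eqP pw us] := blocked; move: (cLM).
  rewrite chain_cat /= => /and5P[_ _ /eqP pE _ _].
  have pu : weight p = (chain_state 0 L + 5)%N by lia.
  rewrite -pu us -pE eqxx /= -cat_rcons -(size_rcons (rcons _ _) (inr p)) => frozen.
  rewrite -(chain_state_rcons 0 (rcons L (inl s)) (inr p)); apply: IHn => //; first lia.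
    by rewrite !cat_rcons.
  by case: M {Mn cLM cLM' unmoved frozen} ends => [|x M] [|ends] //; [left|right].
case/andP => unmoved; rewrite -cat_rcons -(size_rcons L (inr p)) => frozen.
move: (cLM); rewrite chain_cat /= => /and4P[_ /eqP pE uw _].
have near : (weight p < chain_state 0 L + 5)%N.
  by rewrite ltnNge; apply: contra unmoved => far; apply: can_move_back_far.
rewrite -(chain_state_rcons 0 L (inr p)) IHn ?cat_rcons ?andbT //.
- rewrite pE !inE; have /or3P : [|| weight p == (chain_state 0 L).+2,
    weight p == (chain_state 0 L).+3 | weight p == (chain_state 0 L).+4] by lia.
  by case=> /eqP ->; rewrite eqxx ?orbT.
- by case: M {Mn cLM frozen unmoved} ends => [|x M] [|ends] //; [left|right].
by rewrite -cat_rcons.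
Qed.

Lemma packed_ends_with_pair u L : packed u L -> ends_with_pair L.
Proof.
have last_pairs M p : ends_with_pair M -> ends_with_pair (inr p :: M) by case: M.
move: u L; apply: packed_ind => // [u p L _ _ _|u s L _ _]; first exact: last_pairs.
by move/(last_pairs _ (pair_of (u + 5))).
Qed.

(** Without moveable singletons the word is empty or ends with a pair, and
    condition (ii) on base partitions is void. *)
Lemma base_partition_packed s : is_partition s ->
  base_partition s && (moveable (items s) == [::]) =
  at_most_twice s && packed 0 (items s).
Proof.
move=> ps; rewrite /base_partition ps /=; case: (boolP (at_most_twice s)) => //= s2.
have cs := partition_chain0 ps s2.
apply/andP/idP => [[/andP[frozen _] ends]|pits].
  apply: (@frozen_packed [::]) => //; right; by rewrite -moveable_nil.
rewrite moveable_nil (packed_ends_with_pair pits); split=> //.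
apply/andP; split; first by apply: (packed_frozen pits (L := [::])); left.
by have /eqP -> : moveable (items s) == [::] by rewrite moveable_nil (packed_ends_with_pair pits).
Qed.

(** * Blocks, free pairs, and the polynomials P *)

Lemma num_blocks_cons x L :
  num_blocks (x :: L) = (block_at (x :: L) 0 + num_blocks L)%N.
Proof.
rewrite /num_blocks [iota _ _]/= /= (iotaDl 1 0) count_map.
by congr addn; apply: eq_count => j; case: L.
Qed.

Lemma in_block_cons x L i :
  in_block (x :: L) i =
  (block_at (x :: L) 0 && (i <= 2)%N) || ((0 < i)%N && in_block L i.-1).
Proof.
rewrite /in_block /= (iotaDl 1 0) has_map; congr orb.
case: i => [|i] /=; first by apply/hasP => -[j _ /and3P[]].
by apply: eq_has => j; case: L.
Qed.

Lemma num_free_pairs_cons A x L : ~~ block_at (x :: L) 0 ->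
  num_free_pairs A (x :: L) =
  (((if x is inr p then A p else false) : bool) + num_free_pairs A L)%N.
Proof.
move=> noblock; rewrite /num_free_pairs /= (iotaDl 1 0) count_map.
rewrite in_block_cons (negPf noblock) /=; congr addn; apply: eq_count => i /=.
by rewrite in_block_cons (negPf noblock).
Qed.

Lemma num_free_pairs_block A x y z L : block_at [:: x, y, z & L] 0 ->
  ~~ block_at [:: y, z & L] 0 -> ~~ block_at (z :: L) 0 ->
  num_free_pairs A [:: x, y, z & L] = num_free_pairs A L.
Proof.
move=> bx by_ bz; rewrite /num_free_pairs /= (iotaDl 3 0) count_map.
rewrite !in_block_cons bx /= !add0n; apply: eq_count => i /=.
by rewrite !in_block_cons bx (negPf by_) (negPf bz) /=.
Qed.

Definition starts_with_singleton (L : seq item) : bool :=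
  get_singleton (head (inr (0, 0)%N) L).

(** In a packed word each singleton stands inside a block, so that a pair begins
    a block exactly when a singleton follows. *)
Lemma block_at_packed p L : p = pair_of (weight p) -> packed (weight p) L ->
  block_at (inr p :: L) 0 = starts_with_singleton L.
Proof.
move=> pE; case: L => [|[s|q] [|[t|q'] L]] //=; try by case: p {pE}.
case/and3P => /eqP us /eqP -> _; move: (weight p) pE us => w -> us.
by rewrite /starts_with_singleton /block_at /=; lia.
Qed.

Lemma num_blocks_packed u L : packed u L ->
  (num_blocks L + starts_with_singleton L = num_singletons L)%N.
Proof.
move: u L; apply: packed_ind => // [u p L pE _ uL IH|u s L us uL IH].
  by rewrite num_blocks_cons block_at_packed //= -IH; lia.
rewrite !num_blocks_cons block_at_packed ?weight_pair_of //= -IH; lia.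
Qed.

(** A block ends with a pair of even weight, which cannot begin another block;
    hence blocks are disjoint, and each contains two of the pairs. *)
Lemma num_free_pairs_packed u L : packed u L -> ~~ starts_with_singleton L ->
  (num_free_pairs (fun p => p.2 == p.1) L +
   num_free_pairs (fun p => p.2 == p.1.+1) L + 2 * num_blocks L = num_pairs L)%N.
Proof.
have [n] := ubnP (size L); elim: n L u => // n IHn [|[s|p] L] u //= Ln /andP[pw uL] _.
have pE : p = pair_of (weight p).
  by move: pw; rewrite !inE => /or3P[] /eqP ->; rewrite weight_pair_of.
have := block_at_packed pE uL; case: (boolP (starts_with_singleton L)) => sL bL.
  case: L sL uL bL Ln => [|[s|?] [|[?|q] L]] //= _ /and3P[/eqP us /eqP qE uL] bL Ln.
  have qL : ~~ starts_with_singleton L.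
    case: L uL {bL Ln} => [|[t|p'] [|[?|q'] L]] //= /and3P[/eqP tE _ _]; lia.
  have bqL : block_at (inr q :: L) 0 = false.
    by rewrite block_at_packed ?(negPf qL) // qE weight_pair_of.
  rewrite !num_free_pairs_block ?bL ?bqL // !num_blocks_cons bL bqL /=.
  by rewrite -(IHn L _ _ uL qL); lia.
rewrite !num_free_pairs_cons ?bL // num_blocks_cons bL -(IHn L _ _ uL sL) //.
have : ((p.2 == p.1) + (p.2 == p.1.+1) = 1)%N by rewrite pE /=; lia.
by lia.
Qed.

Lemma last_pair_packed L : packed 0 L -> (last_pair L).1 = (chain_state 0 L)./2.
Proof.
move=> pL; have := packed_chain pL; have := packed_ends_with_pair pL.
case/lastP: L {pL} => // L [s|p]; rewrite /ends_with_pair last_rcons // => _.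
rewrite -cats1 chain_cat => /andP[_ /= /and3P[/eqP pE _ _]].
by rewrite cats1 last_pair_rcons chain_state_rcons {1}pE.
Qed.

(** The parameters under which a base partition without moveable singletons is
    counted: m1, m2, m3 and the smaller part of the largest pair. *)
Definition packed_type (L : seq item) : nat * nat * nat * nat :=
  (num_free_pairs (fun p => p.2 == p.1) L, num_free_pairs (fun p => p.2 == p.1.+1) L,
   num_blocks L, (last_pair L).1).

(** There are finitely many packed words with a given number of pairs, so that P
    is a polynomial.  The formula also covers m1 = m2 = m3 = 0, where the empty
    word is the only term. *)
Lemma P_packed m1 m2 m3 M :
  P m1 m2 m3 M =
  \sum_(L <- packed_seqs (m1 + m2 + 2 * m3) 0 |
      [&& (packed_type L).1 == (m1, m2, m3) & (packed_type L).2%:Z + 1 == M])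
    fpsX ^+ items_weight L.
Proof.
rewrite /P; case: ifP => [/and3P[/eqP -> /eqP -> /eqP ->]|_].
  rewrite big_cons big_nil /= /last_pair /= add0r eq_sym; case: eqP => _ //.
  by rewrite addr0.
set A := (X in genfun X).
pose B L := packed 0 L && (((packed_type L).1 == (m1, m2, m3)) && ((packed_type L).2%:Z + 1 == M)).
have -> : genfun A = genfun (fun s => at_most_twice s && B (items s)).
  apply: eq_genfun => s ps; rewrite /A /B /= [RHS]andbA -base_partition_packed // -!andbA.
  by rewrite /packed_type /=; case: (_ == m3); rewrite /= ?andbF.
have BP := is_genfun_items (A := B) (fun L BL => packed_chain (andP BL).1).
apply: is_genfun_inj BP _; apply: eq_is_genfun (is_genfun_seq _ _ (uniq_packed_seqs _ 0)) => L.
rewrite /B; case: (boolP (packed 0 L)) => pL /=; last first.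
  by apply/negP => /andP[/packed_seqsP[pL']]; rewrite pL' in pL.
apply: andb_idl => /andP[/eqP[<- <- <-] _]; apply/packed_seqsP; split=> //.
have nL : ~~ starts_with_singleton L.
  by case: L pL => [|[s|?] [|[?|p] L]] //= /and3P[/eqP]; lia.
by rewrite -(num_free_pairs_packed pL nL).
Qed.

Lemma packed_typeE L m1 m2 m3 m : packed 0 L -> packed_type L = (m1, m2, m3, m) ->
  [/\ num_pairs L = (m1 + m2 + 2 * m3)%N, num_singletons L = m3
    & m = (chain_state 0 L)./2].
Proof.
move=> pL [<- <- <- <-]; have nL : ~~ starts_with_singleton L.
  by case: L pL => [|[s|?] [|[?|p] L]] //= /and3P[/eqP]; lia.
rewrite -(num_free_pairs_packed pL nL) -(num_blocks_packed pL) (negPf nL) addn0.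
by split=> //; apply: last_pair_packed.
Qed.

(** * The infinite product *)

Lemma leq_sumn x (s : seq nat) : x \in s -> (x <= sumn s)%N.
Proof.
elim: s => //= y s IHs; rewrite inE => /orP[/eqP->|/IHs xs]; first exact: leq_addr.
exact: leq_trans xs (leq_addl _ _).
Qed.

Definition bounded_class (N m : nat) (s : seq nat) : bool :=
  [&& is_partition s, at_most_twice s, all (geq N) s & size s == m].

Lemma bounded_classS N m (s : seq nat) : bounded_class N.+1 m s ->
  s = [seq x <- s | (x <= N)%N] ++ nseq (count_mem N.+1 s) N.+1.
Proof.
case/and4P => /andP[ss _] _ sN _; rewrite {m}; elim: s ss sN => //= x s IHs xs /andP[xN sN].
have {IHs} IHs := IHs (path_sorted xs) sN.
case: (leqP x N) => [xN'|Nx]; first by rewrite (ltn_eqF (_ : x < N.+1)%N) // add0n {1}IHs.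
have -> : x = N.+1 by apply/eqP; rewrite eqn_leq xN.
rewrite eqxx add1n /=; have /all_pred1P sE : all (pred1 N.+1) s.
  apply/allP => y ys /=; have /= yN := allP sN _ ys; rewrite eqn_leq yN.
  exact: leq_trans Nx (allP (sorted_all xs) _ ys).
have s0 : [seq y <- s | (y <= N)%N] = [::].
  by rewrite sE filter_nseq ltnn.
by rewrite {1}IHs s0.
Qed.

Lemma bounded_class_cat N m j (s : seq nat) : (j <= 2)%N -> (j <= m)%N ->
  all (geq N) s ->
  bounded_class N.+1 m (s ++ nseq j N.+1) = bounded_class N (m - j) s.
Proof.
move=> j2 jm sN; rewrite /bounded_class sN.
have -> : is_partition (s ++ nseq j N.+1) = is_partition s.
  rewrite /is_partition !(sorted_pairwise leq_trans) pairwise_cat all_cat all_nseq orbT andbT.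
  have -> : allrel leq s (nseq j N.+1).
    apply/allrelP => x y xs /nseqP[-> _]; exact: leq_trans (allP sN _ xs) _.
  by case: j j2 {jm} => [|[|[|j]]] //= _; rewrite ?leqnn ?andbT.
have -> : at_most_twice (s ++ nseq j N.+1) = at_most_twice s.
  apply/at_most_twiceP/at_most_twiceP => s2 x.
    by apply: leq_trans (s2 x); rewrite count_cat leq_addr.
  rewrite count_cat count_nseq /=; case: eqP => [<-|_]; last by rewrite mul0n addn0.
  have /count_memPn -> : N.+1 \notin s by apply/negP => /(allP sN) /=; rewrite ltnn.
  by rewrite mul1n.
have -> : all (geq N.+1) (s ++ nseq j N.+1).
  by rewrite all_cat all_nseq /= leqnn orbT andbT; apply: sub_all sN => x /= /leqW.
by rewrite size_cat size_nseq; congr [&& _, _ & _]; lia.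
Qed.

(** The factor indexed by N+1 records how often N+1 occurs: the terms 1, t q^(N+1)
    and t^2 q^(2N+2) stand for zero, one and two occurrences. *)
Lemma bounded_class_prod N m :
  is_genfun sumn (bounded_class N m)
    (fps_coef (\prod_(1 <= i < N.+1) (1 + tvar * qvar ^+ i + tvar ^+ 2 * qvar ^+ (2 * i))) m).
Proof.
elim: N m => [|N IHN] m.
  rewrite big_geq // => n.
  exists (if (n == 0%N) && (m == 0%N) then [:: [::]] else [::]); split.
  - by case: ifP.
  - case=> [|x s]; last first.
      rewrite /bounded_class /is_partition /=; case: x => [|x]; rewrite ?andbF; by case: ifP.
    by rewrite /bounded_class /= ![0%N == _]eq_sym andbC; case: ifP.
  by case: m n => [|m] [|n].
rewrite big_nat_recr //; set Q := \prod_(_ <= _ < _) _ in IHN *.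
pose F j := if (j <= m)%N then fpsX ^+ (j * N.+1) * fps_coef Q (m - j) else 0.
have -> : fps_coef (Q * (1 + tvar * qvar ^+ N.+1 + tvar ^+ 2 * qvar ^+ (2 * N.+1))) m =
    \sum_(j <- [:: 0; 1; 2]%N) F j.
  rewrite !big_cons big_nil addr0 /F leq0n mul0n expr0 mul1r subn0 -!fpsCXn.
  rewrite mulrDr mulrDr mulr1 !fps_coefD -addrA; congr (_ + (_ + _)).
    rewrite mulrCA -[tvar]expr1 fps_coefXnM [Q * _]mulrC mul1n.
    by case: ifP => // _; rewrite fps_coefCM.
  by rewrite mulrCA fps_coefXnM [Q * _]mulrC; case: ifP => // _; rewrite fps_coefCM.
apply: (is_genfun_sum (key := count_mem N.+1)) => // [s /and4P[_ /at_most_twiceP s2 _ _]|j j2].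
  by move: (s2 N.+1); case: (count_mem N.+1 s) => [|[|[|]]].
have {}j2 : (j <= 2)%N by move: j2; rewrite !inE; lia.
rewrite /F; case: (leqP j m) => jm; last first.
  apply: is_genfun0 => s; apply/negP => /andP[/and4P[_ _ _ /eqP sm]] /eqP sj.
  by move: (count_size (pred1 N.+1) s); rewrite sj sm leqNgt jm.
have filter_bounded (s : seq nat) : all (geq N) [seq x <- s | (x <= N)%N] by exact: filter_all.
apply: (is_genfun_bij (f := fun s => s ++ nseq j N.+1)
  (g := fun s => [seq x <- s | (x <= N)%N]) _ _ (IHN (m - j)%N)) => [s cs|s /andP[cs /eqP sj]].
  have /and4P[_ _ sN _] := cs; split.
  - rewrite bounded_class_cat // cs count_cat count_nseq /= eqxx mul1n.
    have /count_memPn -> : N.+1 \notin s by apply/negP => /(allP sN) /=; rewrite ltnn.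
    by rewrite add0n eqxx.
  - by rewrite sumn_cat sumn_nseq mulnC.
  rewrite filter_cat filter_nseq ltnn cats0; exact/all_filterP.
have sE := bounded_classS cs; rewrite sj in sE; rewrite -sE; split=> //.
by rewrite -(bounded_class_cat j2 jm) // -sE.
Qed.

(** * Assembling the identity *)

Definition Hseries : Zqt :=
  Fps (fun m => genfun (fun s => at_most_twice s && (size s == m))).

Lemma Hseries_prod :
  prod_converges_to
    (fun n => 1 + tvar * qvar ^+ n + tvar ^+ 2 * qvar ^+ (2 * n)) Hseries.
Proof.
move=> n m; exists n => N nN; rewrite /coef_qt.
have [l [Ul lP ->]] := @bounded_class_prod N m n.
have [l' [Ul' lP' ->]] := is_genfun_genfun (fun s => at_most_twice s && (size s == m)) n.
congr Posz; apply/perm_size/uniq_perm => // s; rewrite lP lP' /bounded_class -!andbA.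
case: (sumn s =P n) => [sn|]; last by rewrite !andbF.
do 2 congr andb; rewrite (_ : all _ _) //; apply/allP => x /leq_sumn /= xs.
by rewrite (leq_trans xs) // sn.
Qed.

Lemma Hseries_sum :
  sums_to (fun '((m, n) : nat * nat) => (h n m)%:R * qvar ^+ n * tvar ^+ m) Hseries.
Proof.
have coefE m n n' m' : coef_qt ((h n m)%:R * qvar ^+ n * tvar ^+ m) n' m' =
    if (m, n) == (m', n') then (h n m)%:Z else 0.
  rewrite /coef_qt /qvar /tvar -fpsC_nat -fpsCXn.
  rewrite -fpsCM fps_coefCXn -fpsC_nat xpair_eqE ![_ == m']eq_sym.
  case: eqP => _ //; rewrite fps_coefCXn natz eq_sym.
  by case: eqP.
move=> n m; exists [:: (m, n)]; split=> // [[m' n']|]; last first.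
  by rewrite big_seq1 coefE eqxx.
by rewrite inE coefE => /negPf ->.
Qed.

Lemma uniq_flatten_key (S T : eqType) (r : seq S) (f : S -> seq T) (key : T -> S) :
  uniq r -> (forall i, uniq (f i)) -> (forall i x, x \in f i -> key x = i) ->
  uniq (flatten (map f r)).
Proof.
move=> Ur Uf fkey; elim: r Ur => //= i r IHr /andP[ir /IHr Ur].
rewrite cat_uniq Uf Ur andbT; apply/hasPn => x /flatten_mapP[j jr /fkey xj].
by apply/negP => /fkey xi; move: ir; rewrite -xi xj jr.
Qed.

Lemma sum_by_key (R : nmodType) (T I : eqType) (l : seq T) (key : T -> I) (F : T -> R) :
  \sum_(x <- l) F x = \sum_(i <- undup (map key l)) \sum_(x <- l | key x == i) F x.
Proof.
rewrite (exchange_big_dep predT) //=; apply: eq_big_seq => x xl.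
rewrite big_mkcond (bigD1_seq (key x)) ?undup_uniq ?mem_undup ?map_f //= eqxx.
by rewrite big1 ?addr0 // => i; rewrite eq_sym => /negPf ->.
Qed.

Notation params := (nat * nat * nat * nat * nat)%type.

Definition factor (i : params) : fps int :=
  let: (m1, m2, m3, m, n12) := i in
  fpsX ^+ (m * n12 + n12 ^ 2)
  / (qpoch fpsX fpsX n12 * qpoch (fpsX ^+ 3) (fpsX ^+ 3) (m1 + m2 + 2 * m3)).

Definition degree (i : params) : nat :=
  let: (m1, m2, m3, m, n12) := i in (2 * m1 + 2 * m2 + 5 * m3 + n12)%N.

Definition packed_index (M : nat) (L : seq item) : params :=
  (packed_type L, M - (2 * num_pairs L + num_singletons L))%N.

(** Packed words that can be completed, by singletons after the last pair, to a
    word with M parts. *)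
Definition packed_upto (M : nat) : seq (seq item) :=
  flatten [seq [seq L <- packed_seqs p 0 | (2 * p + num_singletons L <= M)%N]
          | p <- iota 0 M.+1].

Lemma mem_packed_upto M L :
  (L \in packed_upto M) = packed 0 L && (2 * num_pairs L + num_singletons L <= M)%N.
Proof.
apply/flatten_mapP/andP => [[p _]|[pL LM]].
  by rewrite mem_filter => /andP[? /packed_seqsP[-> ->]].
exists (num_pairs L); first by rewrite mem_iota; lia.
by rewrite mem_filter LM; apply/packed_seqsP.
Qed.

Lemma uniq_packed_upto M : uniq (packed_upto M).
Proof.
apply: (uniq_flatten_key (key := num_pairs)) => [|p|p L].
- exact: iota_uniq.
- exact/filter_uniq/uniq_packed_seqs.
by rewrite mem_filter => /andP[_ /packed_seqsP[]].
Qed.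

Lemma size_parts_of L : size (parts_of L) = (2 * num_pairs L + num_singletons L)%N.
Proof.
by elim: L => [|[s|p] L IHL] //; rewrite parts_ofE /= IHL; lia.
Qed.

(** The product (q^3;q^3)_r cancels, and the rest of the factor is the series of
    the singletons placed after the last pair. *)
Lemma factor_packed M L : packed 0 L ->
  qpoch (fpsX ^+ 3) (fpsX ^+ 3) (num_pairs L) * factor (packed_index M L) =
  chain_gf (chain_state 0 L) 0 (M - 2 * num_pairs L - num_singletons L).
Proof.
rewrite /packed_index => pL; case type_L: (packed_type L) => [[[m1 m2] m3] m].
have [nL _ mE] := packed_typeE pL type_L; rewrite /factor -nL mE.
rewrite subnDA; set n := (_ - _ - _)%N; rewrite -chain_gf_singletons !mulrA.
rewrite [qpoch _ _ (num_pairs L) * _]mulrC [_ * chain_gf _ _ _]mulrC mulrK //.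
by rewrite unitrM (unit_qpoch _ 0) unit_qpoch.
Qed.

(** Each word is split into its number of pairs and of singletons, and
    [packed_sum] is applied to each class. *)
Lemma Hseries_coef M :
  fps_coef Hseries M =
  \sum_(L <- packed_upto M) fpsX ^+ items_weight L * factor (packed_index M L).
Proof.
pose A L := chain 0 L && (2 * num_pairs L + num_singletons L == M)%N.
have -> : fps_coef Hseries M = genfun (fun s => at_most_twice s && A (items s)).
  apply: eq_genfun => s ps; rewrite /A -size_parts_of parts_of_items.
  by apply: andb_id2l => /(partition_chain0 ps) ->.
have AP : is_genfun items_weight A (genfun (fun s => at_most_twice s && A (items s))).
  by apply: is_genfun_items => L /andP[].
rewrite big_flatten big_map; apply: is_genfun_inj AP _.
apply: (is_genfun_sum (key := num_pairs)) => [|L /andP[_ /eqP <-]|p _].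
- exact: iota_uniq.
- by rewrite mem_iota; lia.
rewrite big_filter; case: (leqP (2 * p) M) => pM; last first.
  rewrite big_pred0 => [|L]; last by apply/negbTE; lia.
  by apply: is_genfun0 => L; apply/negP => /andP[/andP[_ /eqP LM] /eqP Lp]; lia.
have -> : \sum_(L <- packed_seqs p 0 | (2 * p + num_singletons L <= M)%N)
    fpsX ^+ items_weight L * factor (packed_index M L) = chain_gf 0 p (M - 2 * p).
  have Up := unit_qpoch int 2 p.
  apply: (mulrI Up); rewrite packed_sum big_distrr [LHS]big_seq_cond [RHS]big_seq_cond.
  apply: eq_big => [L|L /andP[/packed_seqsP[pL Lp] LM]].
    by congr andb; lia.
  by have := factor_packed M pL; rewrite Lp => <-; move: (factor _) => f; rewrite mulrCA.
apply: eq_is_genfun (chain_gfP 0 p (M - 2 * p)) => L.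
by rewrite /chain_class /A -andbA; congr andb; lia.
Qed.

(** For parameters of degree M the packed words counted by P all have room in M
    parts, and the number of singletons to be added is forced to be n12. *)
Lemma P_packed_upto M m1 m2 m3 m n12 :
  degree (m1, m2, m3, m, n12) = M ->
  P m1 m2 m3 (m%:Z + 1) =
  \sum_(L <- packed_upto M | packed_index M L == (m1, m2, m3, m, n12))
    fpsX ^+ items_weight L.
Proof.
move=> dM; rewrite P_packed -big_filter -[RHS]big_filter; apply/perm_big/uniq_perm.
- exact/filter_uniq/uniq_packed_seqs.
- exact/filter_uniq/uniq_packed_upto.
move=> L; rewrite !mem_filter mem_packed_upto.
have -> : (L \in packed_seqs (m1 + m2 + 2 * m3) 0) =
    packed 0 L && (num_pairs L == m1 + m2 + 2 * m3)%N.
  by apply/packed_seqsP/andP => -[-> /eqP].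
case: (boolP (packed 0 L)) => pL; last by rewrite !andbF.
rewrite /packed_index; case type_L: (packed_type L) => [[[k1 k2] k3] k].
have [-> -> _] := packed_typeE pL type_L; rewrite !xpair_eqE.
rewrite (inj_eq (addIr 1)) eqz_nat; move: dM; rewrite /degree [(_, k).2]/=; lia.
Qed.

Definition summand (i : params) : Zqt :=
  let: (m1, m2, m3, m, n12) := i in
  fpsC (P m1 m2 m3 (m%:Z + 1))
  * qvar ^+ (m * n12 + n12 ^ 2)
  * tvar ^+ (2 * m1 + 2 * m2 + 5 * m3 + n12)
  / (qpoch qvar qvar n12 * qpoch (qvar ^+ 3) (qvar ^+ 3) (m1 + m2 + 2 * m3)).

Lemma fps_coef_summand M i :
  fps_coef (summand i) M =
  (\sum_(L <- packed_upto M | packed_index M L == i) fpsX ^+ items_weight L) * factor i.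
Proof.
case: i => -[[[m1 m2] m3] m] n12; rewrite /summand /qvar /tvar -!fpsCXn.
rewrite -!fpsC_qpoch -!fpsCM -fpsCV; last first.
  by rewrite unitrM unit_qpoch (unit_qpoch _ 0).
rewrite mulrAC -!fpsCM fps_coefCXn -mulrA -[_ / _]/(factor (m1, m2, m3, m, n12)).
rewrite -[(_ + n12)%N]/(degree (m1, m2, m3, m, n12)); case: eqP => [dM|nd].
  by rewrite -(P_packed_upto (esym dM)).
rewrite big1_seq ?mul0r // => L /andP[/eqP]; rewrite mem_packed_upto => Li /andP[pL LM].
have [nL sL _] := packed_typeE pL (congr1 fst Li).
have nE : (M - (2 * num_pairs L + num_singletons L))%N = n12 := congr1 snd Li.
by case: nd; move: LM nE; rewrite /degree nL sL; lia.
Qed.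

Lemma Hseries_sum_P : sums_to summand Hseries.
Proof.
move=> n M; exists (undup (map (packed_index M) (packed_upto M))); split.
- exact: undup_uniq.
- move=> i; rewrite mem_undup => iM; rewrite /coef_qt fps_coef_summand big1_seq ?mul0r //.
  by move=> L /andP[/eqP Li LM]; rewrite -Li map_f in iM.
rewrite /coef_qt Hseries_coef (sum_by_key _ (packed_index M)) fps_coef_sum.
apply: eq_bigr => i _; rewrite fps_coef_summand big_distrl.
by apply: (congr1 (fun f => fps_coef f n)); apply: eq_bigr => L /eqP Li; rewrite Li.
Qed.

Lemma P_polynomial m1 m2 m3 M : exists p : {poly int},
  P m1 m2 m3 M = fps_of_poly p /\ forall i : nat, 0 <= p`_i.
Proof.
rewrite P_packed; elim/big_ind: _ => [|f g [p [-> p0]] [q [-> q0]]|L _].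
- by exists 0; split=> [|i]; [apply: fpsP => i /=|]; rewrite coef0.
- exists (p + q); split=> [|i]; last by rewrite coefD addr_ge0.
  by apply: fpsP => i /=; rewrite coefD.
exists 'X^(items_weight L); split=> [|i]; last by rewrite coefXn ler0n.
by apply: fpsP => i; rewrite fps_coefXn /= coefXn.
Qed.

Theorem corollary16 :
  (exists H : Zqt,
    [/\ prod_converges_to
          (fun n => 1 + tvar * qvar ^+ n + tvar ^+ 2 * qvar ^+ (2 * n)) H,
        sums_to
          (fun '((m, n) : nat * nat) => (h n m)%:R * qvar ^+ n * tvar ^+ m) H
      & sums_to
          (fun '((m1, m2, m3, m, n12) : nat * nat * nat * nat * nat) =>
             fpsC (P m1 m2 m3 (m%:Z + 1))
             * qvar ^+ (m * n12 + n12 ^ 2)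
             * tvar ^+ (2 * m1 + 2 * m2 + 5 * m3 + n12)
             / (qpoch qvar qvar n12
                * qpoch (qvar ^+ 3) (qvar ^+ 3) (m1 + m2 + 2 * m3))) H])
  /\
  (forall (m1 m2 m3 : nat) (M : int), exists p : {poly int},
     P m1 m2 m3 M = fps_of_poly p /\ forall i : nat, 0 <= p`_i).
Proof.
split; last exact: P_polynomial.
by exists Hseries; split; [exact: Hseries_prod|exact: Hseries_sum|exact: Hseries_sum_P].
Qed.
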